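(* Let $G$ be an affine algebraic group over $\Bbbk$, let $H=G^0$ be its identity component, and let $g\in G$. Let $\varphi_g: H\to H$ be the automorphism $h\mapsto g^{-1}hg$. Then the following conditions are equivalent: (1) the connected component $gH$ is periodic; (2) the subgroup $H^{\varphi_g}=\{h\in H\mid \varphi_g(h)=h\}$ of fixed points of $\varphi_g$ is finite; (3) the action of $H$ on $gH$ by conjugation, $h\cdot x=hxh^{-1}$, is transitive.
   Context: $\Bbbk$ is an algebraically closed field of characteristic zero. A connected component of an affine algebraic group is called periodic if all its elements have finite order. *)

(* Defs.v *)
From HB Require Import structures.
From mathcomp Require Import all_boot all_order all_algebra.
From mathcomp Require Import boolp classical_sets functions cardinality topology.
(* The notations of [mpoly] clash with those of [topology]. *)
From mathcomp Require Import -(notations) mpoly.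

Set Implicit Arguments.
Unset Strict Implicit.
Unset Printing Implicit Defensive.

Import GRing.Theory.
Local Open Scope classical_set_scope.
Local Open Scope ring_scope.

(* An alias of 'rV[k]_n, so that it can carry the Zariski topology. *)
Definition affine_space (k : fieldType) (n : nat) : Type := 'rV[k]_n.

HB.instance Definition _ (k : fieldType) (n : nat) :=
  Choice.copy (affine_space k n) 'rV[k]_n.

Definition zero_locus (k : fieldType) (n : nat) (S : set (mpoly n k)) :
    set (affine_space k n) :=
  [set v | forall p, S p -> meval (fun i => (v : 'rV[k]_n) ord0 i) p = 0].

Definition zariski_open (k : fieldType) (n : nat) : set_system (affine_space k n) :=
  [set U | exists S, ~` U = zero_locus S].

Section ZariskiTopology.
Variables (k : fieldType) (n : nat).

Lemma zariski_openT : @zariski_open k n setT.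
Proof.
exists [set (1 : mpoly n k)]; rewrite setCT; apply/seteqP; split=> v //= v0.
have /eqP := v0 1 erefl.
by rewrite [X in X == 0](rmorph1 (meval _)) oner_eq0.
Qed.

Lemma zariski_openI : setI_closed (@zariski_open k n).
Proof.
move=> U V [S US] [T VT]; exists [set r | exists p q, [/\ S p, T q & r = p * q]].
rewrite setCI US VT; apply/seteqP; split=> v /=.
  move=> H r [p [q [Sp Tq ->]]]; rewrite mevalM.
  by case: H => [/(_ p Sp)|/(_ q Tq)] ->; rewrite ?mul0r ?mulr0.
move=> H; apply: contrapT => /not_orP[/existsNP[p /not_implyP[Sp p0]]].
move=> /existsNP[q /not_implyP[Tq q0]].
have /eqP := H (p * q) (ex_intro _ p (ex_intro _ q (And3 Sp Tq erefl))).
by rewrite mevalM mulf_eq0 => /orP[] /eqP.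
Qed.

Lemma zariski_open_bigU (J : Type) (f : J -> set (affine_space k n)) :
  (forall i, zariski_open (f i)) -> zariski_open (\bigcup_i f i).
Proof.
move=> /choice[S fS]; exists (\bigcup_i S i); rewrite setC_bigcup.
apply/seteqP; split=> v /=.
  by move=> H p [i _ Sp]; have := H i I; rewrite fS; exact.
by move=> H i _; rewrite fS => p Sp; apply: H; exists i.
Qed.

HB.instance Definition _ := isOpenTopological.Build (affine_space k n)
  zariski_openT zariski_openI zariski_open_bigU.

End ZariskiTopology.

Lemma zariski_closedP (k : fieldType) (n : nat) (A : set (affine_space k n)) :
  closed A <-> exists S, A = zero_locus S.
Proof.
rewrite -openC; split=> -[S H]; exists S; by rewrite setCK in H *.
Qed.

Definition polynomial_map (k : fieldType) (m n : nat)
    (p : 'I_n -> mpoly m k) (v : 'rV[k]_m) : 'rV[k]_n :=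
  \row_i meval (fun j => v ord0 j) (p i).

(* The structure of an affine algebraic group on an abstract group [G]: [affine_coord]
   identifies [G] with a Zariski closed subset of affine space, and the product
   (on G x G inside the affine space of dimension adim + adim) and the inverse
   are morphisms of affine varieties, i.e. restrictions of polynomial maps. *)
Record affine_algebraic_group (k : closedFieldType) (G : groupType) := {
  adim : nat;
  affine_coord : G -> affine_space k adim;
  affine_coord_inj : injective affine_coord;
  affine_coord_closed : closed (range affine_coord);
  mul_regular : exists p : 'I_adim -> mpoly (adim + adim) k,
    forall x y : G, affine_coord (x * y)%g = polynomial_map p (row_mx (affine_coord x) (affine_coord y));
  inv_regular : exists p : 'I_adim -> mpoly adim k,
    forall x : G, affine_coord (x^-1)%g = polynomial_map p (affine_coord x)
}.

Definition identity_component (k : closedFieldType) (G : groupType)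
    (A : affine_algebraic_group k G) : set G :=
  affine_coord A @^-1` connected_component (range (affine_coord A)) (affine_coord A 1%g).

Section Groups.
Local Open Scope group_scope.

Definition left_coset (G : groupType) (g : G) (H : set G) : set G :=
  [set g * h | h in H].

Definition finite_order (G : groupType) (x : G) : Prop :=
  exists2 n : nat, (0 < n)%N & x ^+ n = 1.

Definition periodic (G : groupType) (X : set G) : Prop :=
  forall x, X x -> finite_order x.

Definition conj_aut (G : groupType) (g h : G) : G := g^-1 * h * g.

Definition fixed_points (G : groupType) (H : set G) (phi : G -> G) : set G :=
  [set h | H h /\ phi h = h].

Definition conj_transitive (G : groupType) (H X : set G) : Prop :=
  forall x y, X x -> X y -> exists2 h, H h & h * x * h^-1 = y.

End Groups.

(* Main.v *)
Require Import Defs.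
From mathcomp Require Import all_boot all_order all_algebra.
From mathcomp Require Import boolp classical_sets functions cardinality topology.
From mathcomp Require Import -(notations) mpoly.
From mathcomp Require Import closed_field separable cyclotomic.

(* Fix a faithful representation of G.

   (1) => (2): the eigenvalues of the elements of gH form a constructible subset of k,
   consisting of roots of unity. It misses the integers 2, 3, ..., so it is finite, and
   gH has a finite exponent m. If h in H commutes with g, then h^m = (gh)^m = 1. A closed
   subgroup of exponent m is finite: on it, the trace of 1 + x + ... + x^(m-1) is m times
   the multiplicity of the eigenvalue 1, so it takes finitely many values, hence it is
   constant on irreducible subsets, and these are points.

   (2) => (3): the powers of g that lie in H are fixed by phi_g, so g^m = 1 for some m > 0.
   The map h |-> g^-1 h g h^-1 from H to H has finite fibres, hence a dense image; so the
   conjugates of g are dense in gH, and x^m = 1 on gH. By (1) => (2), now every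
   x in gH has a finite centralizer in H, hence an H-orbit which is dense and,
   being constructible, contains a nonempty open subset of gH; two such orbits meet.

   (3) => (1): all g^(1+Mi) with g^M in H are conjugate to g, so the eigenvalues of g are
   roots of unity, and u = g^m is unipotent in H for some m > 0. The one-parameter group
   u^t lies in H and commutes with g, and (g u^(-1/m))^m = 1. *)

Set Implicit Arguments.
Unset Strict Implicit.
Unset Printing Implicit Defensive.

Import Order.TTheory GRing.Theory.
Local Open Scope classical_set_scope.
Local Open Scope ring_scope.

(** * Noetherian rings *)

Definition ideal_gen (R : comNzRingType) (S : set R) : set R :=
  [set f | exists2 s : seq (R * R), (forall x, x \in s -> S x.2) &
                                    f = \sum_(x <- s) x.1 * x.2].

(** The finitely many generators are drawn from the arbitrary set [S] itself; in this form systems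
    of equations are later cut down to finite ones. *)
Definition noetherian (R : comNzRingType) : Prop :=
  forall S : set R, exists2 s : seq R, (forall x, x \in s -> S x) &
    S `<=` ideal_gen [set` s].

Section IdealGen.
Variable R : comNzRingType.
Implicit Types (S T : set R) (f g r : R).

Lemma ideal_gen0 S : ideal_gen S 0.
Proof. by exists [::] => //; rewrite big_nil. Qed.

Lemma ideal_genD S f g : ideal_gen S f -> ideal_gen S g -> ideal_gen S (f + g).
Proof.
move=> [s sS ->] [t tS ->]; exists (s ++ t); last by rewrite big_cat.
by move=> x; rewrite mem_cat => /orP[/sS|/tS].
Qed.

Lemma ideal_genM S r f : ideal_gen S f -> ideal_gen S (r * f).
Proof.
move=> [s sS ->]; exists [seq (r * x.1, x.2) | x <- s].
  by move=> x /mapP[y ys ->]; apply: (sS _ ys).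
by rewrite big_map mulr_sumr; apply: eq_bigr => x _; rewrite mulrA.
Qed.

Lemma ideal_genB S f g : ideal_gen S f -> ideal_gen S g -> ideal_gen S (f - g).
Proof. by move=> Sf Sg; rewrite -mulN1r; apply: ideal_genD => //; exact: ideal_genM. Qed.

Lemma ideal_gen_sub S : S `<=` ideal_gen S.
Proof.
move=> f Sf; exists [:: (1, f)]; last by rewrite big_seq1 mul1r.
by move=> x /[!inE] /eqP ->.
Qed.

Lemma ideal_gen_min S T : S `<=` ideal_gen T -> ideal_gen S `<=` ideal_gen T.
Proof.
move=> ST _ [s sS ->]; elim: s sS => [|x s IHs] sS.
  by rewrite big_nil; exact: ideal_gen0.
rewrite big_cons; apply: ideal_genD.
  by apply: ideal_genM; apply: ST; apply: sS; rewrite mem_head.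
by apply: IHs => y ys; apply: sS; rewrite inE ys orbT.
Qed.

Lemma ideal_genS S T : S `<=` T -> ideal_gen S `<=` ideal_gen T.
Proof. by move=> ST; apply: ideal_gen_min => f /ST; exact: ideal_gen_sub. Qed.

(** Each element of the list involves only finitely many members of [S]; collecting them turns
    generators in the ideal into generators in [S]. *)
Lemma ideal_gen_seq S (s : seq R) : (forall x, x \in s -> ideal_gen S x) ->
  exists2 t : seq R, (forall x, x \in t -> S x) &
    ideal_gen [set` s] `<=` ideal_gen [set` t].
Proof.
elim: s => [|x s IHs] sS.
  by exists [::].
have [|t tS st] := IHs; first by move=> y ys; apply: sS; rewrite inE ys orbT.
have [u uS xE] : ideal_gen S x by apply: sS; rewrite mem_head.
exists ([seq y.2 | y <- u] ++ t).
  by move=> y; rewrite mem_cat => /orP[/mapP[z zu ->]|/tS //]; exact: uS.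
apply: ideal_gen_min => y /=; rewrite inE => /orP[/eqP->|ys].
  exists u => // z zu; rewrite /= mem_cat; apply/orP; left; exact: map_f.
apply: (@ideal_genS [set` t]) => [z /= zt|]; first by rewrite mem_cat zt orbT.
by apply: st; exact: ideal_gen_sub.
Qed.

End IdealGen.

Lemma noetherian_field (k : fieldType) : noetherian k.
Proof.
move=> S; have [[f [Sf f0]]|S0] := pselect (exists f, S f /\ f != 0).
  exists [:: f] => [x /[!inE] /eqP->//|g Sg].
  by exists [:: (g / f, f)]; rewrite ?big_seq1 /= ?mulfVK // => x; rewrite !inE => /eqP->/=.
exists [::] => // f Sf; have [->|f0] := eqVneq f 0; first exact: ideal_gen0.
by exfalso; apply: S0; exists f.
Qed.

Lemma noetherian_surj (R R' : comNzRingType) (psi : {rmorphism R' -> R}) :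
  (forall x, exists y, psi y = x) -> noetherian R' -> noetherian R.
Proof.
move=> /choice[phi phiK] noeth S; have [s sS Ss] := noeth (phi @` S).
exists [seq psi x | x <- s] => [x /mapP[y /sS[z Sz <-] ->]|f Sf].
  by rewrite phiK.
have [t ts fE] : ideal_gen [set` s] (phi f) by apply: Ss; exists f.
exists [seq (psi x.1, psi x.2) | x <- t].
  by move=> x /mapP[y /ts ys ->]; exact: map_f.
rewrite -(phiK f) fE rmorph_sum big_map; apply: eq_bigr => x _.
exact: rmorphM.
Qed.

(** Hilbert's basis theorem. If [S] is not finitely generated, choose [f j] of least size in the
    ideal outside the ideal of its predecessors. Finitely many leading coefficients generate all of
    them, so the leading term of a later [f m] can be cancelled, against minimality. *)
Lemma noetherian_poly (R : comNzRingType) : noetherian R -> noetherian {poly R}.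
Proof.
move=> noeth S; apply: contrapT => Sinf.
pose I := ideal_gen S.
(* The premise makes the choice total: a list not contained in [I] gets the dummy value 0. *)
have next (s : seq {poly R}) : exists f, (forall x, x \in s -> I x) ->
    [/\ I f, ~ ideal_gen [set` s] f &
        forall g, I g -> ~ ideal_gen [set` s] g -> (size f <= size g)%N].
  have [sI|] := pselect (forall x, x \in s -> I x); last by exists 0.
  have [f0 [If0 sf0]] : exists f, I f /\ ~ ideal_gen [set` s] f.
    apply: contrapT => /forallNP Is; apply: Sinf.
    have [t tS st] := ideal_gen_seq sI; exists t => // f Sf; apply: st.
    by have /not_andP[|/contrapT//] := Is f; case; exact: ideal_gen_sub.
  pose P d := `[< exists f, [/\ I f, ~ ideal_gen [set` s] f & size f = d] >].
  have exP : exists d, P d by exists (size f0); apply/asboolP; exists f0.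
  case: (ex_minnP exP) => d /asboolP[f [If sf fd]] dmin.
  exists f => _; split=> // g Ig sg; rewrite fd; apply: dmin.
  by apply/asboolP; exists g.
have {next} [next nextP] := choice next.
pose l := fix l j := if j is j.+1 then next (l j) :: l j else [::].
pose f j := next (l j).
have lI j x : x \in l j -> I x.
  elim: j x => // j IHj x /=; rewrite inE => /orP[/eqP->|/IHj//].
  by have [] := nextP (l j) IHj.
have lS i j : (i <= j)%N -> {subset l i <= l j}.
  move=> /subnK <-; elim: (j - i)%N => // d IHd x /IHd xd.
  by rewrite addSn /= inE xd orbT.
have fl i j : (i < j)%N -> f i \in l j.
  by move=> /lS; apply; rewrite /= mem_head.
have fP j := nextP (l j) (@lI j).
have f_le i j : (i <= j)%N -> (size (f i) <= size (f j))%N.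
  move=> ij; have [_ _] := fP i; apply; have [// _ nfj _] := fP j.
  by move=> fj; apply: nfj; apply: ideal_genS fj => x /(lS _ _ ij).
have [a aS Sa] := noeth (range (fun j => lead_coef (f j))).
have [m am] : exists m, forall x, x \in a ->
    exists2 i, (i < m)%N & lead_coef (f i) = x.
  elim: a aS {Sa} => [|x a IHa] aS; first by exists 0%N.
  have [|m am] := IHa; first by move=> y ya; apply: aS; rewrite inE ya orbT.
  have [i _ xE] : range (fun j => lead_coef (f j)) x by apply: aS; rewrite mem_head.
  exists (maxn i.+1 m) => y; rewrite inE => /orP[/eqP->|/am[j jm <-]].
    by exists i => //; rewrite leq_max ltnSn.
  by exists j => //; rewrite leq_max jm orbT.
pose D := size (f m).
(* Multiplication by powers of ['X] brings the [f i] with [i < m] up to size [D], so that their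
   leading coefficients add up in degree [D.-1]. *)
have lead_lift c : ideal_gen [set` a] c ->
    exists h, [/\ ideal_gen [set` l m] h, (size h <= D)%N & h`_D.-1 = c].
  move=> [s sa ->]; elim: s sa => [|x s IHs] sa.
    by exists 0; rewrite size_poly0 coef0 big_nil; split=> //; exact: ideal_gen0.
  have [|h [lh hD hc]] := IHs; first by move=> y ys; apply: sa; rewrite inE ys orbT.
  have [|i im xE] := am x.2; first by apply: sa; rewrite mem_head.
  have iD : (size (f i) <= D)%N by apply/f_le/ltnW.
  have fi0 : f i != 0.
    by apply/eqP => fi0; have [_ []] := fP i; rewrite -/(f i) fi0; exact: ideal_gen0.
  have fi_gt0 : (0 < size (f i))%N by rewrite lt0n size_poly_eq0.
  exists (x.1%:P * 'X^(D - size (f i)) * f i + h); split.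
  - by apply: ideal_genD => //; apply: ideal_genM; apply: ideal_gen_sub; exact: fl.
  - rewrite (leq_trans (size_polyD _ _)) // geq_max hD andbT -mulrA mul_polyC.
    rewrite (leq_trans (size_scale_leq _ _)) // mulrC size_mulXn //.
    by rewrite subnK.
  - rewrite coefD hc big_cons; congr (_ + _).
    rewrite -mulrA coefCM mulrC (mulrC 'X^_) coefMXn -xE mulrC; congr (_ * _).
    rewrite lead_coefE; move: fi_gt0 iD; case: (size _) => // d _; case: (D) => // D'.
    by rewrite ltnS subSS /= => dD'; rewrite ltnNge leq_subr /= subKn.
have [h [lh hD hc]] := lead_lift (lead_coef (f m)) (Sa _ (imageT _ _)).
have [Ifm nfm fmin] := fP m.
have Ih : I h by apply: ideal_gen_min lh => x /= /lI.
(* [f m - h] is still outside the ideal of [l m], but its coefficient in degree [D.-1] is 0, so it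
   is smaller than [f m]. *)
have := fmin (f m - h) (ideal_genB Ifm Ih); rewrite -/(f m) -/D => /(_ _)/wrap[].
  by move=> lg; apply: nfm; rewrite -/(f m) -[f m](subrK h); exact: ideal_genD.
have fm0 : f m != 0.
  by apply/eqP => fm0; apply: nfm; rewrite -/(f m) fm0; exact: ideal_gen0.
have D0 : (0 < D)%N by rewrite lt0n size_poly_eq0.
rewrite leqNgt; apply/negP; rewrite negbK -(prednK D0) ltnS.
apply/leq_sizeP => j; rewrite leq_eqVlt => /orP[/eqP<-|Dj].
  by rewrite coefB hc lead_coefE subrr.
rewrite prednK // in Dj.
by rewrite coefB !nth_default ?subr0 // (leq_trans _ Dj).
Qed.

Lemma mpoly_subring_ind (k : fieldType) n (P : mpoly n k -> Prop) :
  (forall c, P (mpolyC n c)) -> (forall i, P (mpolyX k (mnm1 i))) ->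
  (forall p q, P p -> P q -> P (p + q)) -> (forall p q, P p -> P q -> P (p * q)) ->
  forall p, P p.
Proof.
move=> PC PX PD PM; elim/mpolyind => [|c m p _ _ Pp].
  by rewrite -mpolyC0.
apply: (PD) => //; rewrite -mul_mpolyC; apply: (PM) => //.
rewrite mpolyXE_id; apply: big_ind => // [|i _]; first by rewrite -mpolyC1.
by elim: (m i) => [|d IHd]; rewrite ?expr0 -?mpolyC1 // exprS; exact: PM.
Qed.

(** By induction on [n]: sending ['X] to the last variable maps [{poly mpoly n k}] onto the ring in
    [n.+1] variables. *)
Lemma noetherian_mpoly (k : fieldType) n : noetherian (mpoly n k).
Proof.
elim: n => [|n IHn].
  pose psi : {rmorphism k -> mpoly 0 k} := mpolyC 0 (R := k).
  apply: (noetherian_surj (psi := psi)) (@noetherian_field k).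
  elim/mpoly_subring_ind => [c|[]//|_ _ [a <-] [b <-]|_ _ [a <-] [b <-]].
  - by exists c.
  - by exists (a + b); rewrite rmorphD.
  - by exists (a * b); rewrite rmorphM.
pose x : mpoly n.+1 k := mpolyX k (mnm1 ord_max).
have xC : commr_rmorph (mwiden (R := k) (n := n)) x by move=> p; exact: mulrC.
apply: (@noetherian_surj _ _ (horner_morph xC)) (noetherian_poly IHn).
elim/mpoly_subring_ind => [c|i|_ _ [a <-] [b <-]|_ _ [a <-] [b <-]].
- by exists (mpolyC n c)%:P; apply: etrans (horner_morphC xC _) _; exact: mwidenC.
- have [j ->|->] := unliftP ord_max i; last by exists 'X; exact: (horner_morphX xC).
  exists (mpolyX k (mnm1 j))%:P; apply: etrans (horner_morphC xC _) _.
  apply: etrans (mwidenX _ _) _; congr (mpolyX _ _).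
  rewrite mnmwiden1; congr mnm1; apply: val_inj => /=.
  by rewrite /bump leqNgt ltn_ord.
- by exists (a + b); rewrite rmorphD.
- by exists (a * b); rewrite rmorphM.
Qed.

(** * Regular functions and Zariski closed sets *)

(** One principle for three classes: regular functions, polynomial functions of a parameter and,
    through the group law, functions of finite rank. *)
Lemma meval_closed (k : fieldType) (X : Type) (P : (X -> k) -> Prop) :
  (forall a, P (fun=> a)) -> (forall f g, P f -> P g -> P (fun x => f x + g x)) ->
  (forall f g, P f -> P g -> P (fun x => f x * g x)) ->
  forall n (v : X -> 'I_n -> k) p, (forall i, P (v ^~ i)) -> P (fun x => meval (v x) p).
Proof.
move=> PC PD PM n v + Pv; elim/mpoly_subring_ind => [a|i|p q Pp Pq|p q Pp Pq].
- by under eq_fun do rewrite mevalC.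
- by under eq_fun do rewrite mevalXU; exact: Pv.
- by under eq_fun do rewrite mevalD; exact: PD.
- by under eq_fun do rewrite mevalM; exact: PM.
Qed.

Section Zariski.
Variables (k : fieldType) (T : Type) (n : nat) (c : T -> 'I_n -> k).
Implicit Types (f g : T -> k) (Y Z : set T).

(** [T] is an abstract set with coordinates [c], so that the same notions serve for [G], for [G * k]
    and for affine space itself. *)
Definition regular f := exists p : mpoly n k, forall x, f x = meval (c x) p.

Lemma regular_cst a : regular (fun=> a).
Proof. by exists (mpolyC n a) => x; rewrite mevalC. Qed.

Lemma regular_coord i : regular (c ^~ i).
Proof. by exists (mpolyX k (mnm1 i)) => x; rewrite mevalXU. Qed.

Lemma regularD f g : regular f -> regular g -> regular (fun x => f x + g x).
Proof. by move=> [p fp] [q gq]; exists (p + q) => x; rewrite mevalD fp gq. Qed.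

Lemma regularM f g : regular f -> regular g -> regular (fun x => f x * g x).
Proof. by move=> [p fp] [q gq]; exists (p * q) => x; rewrite mevalM fp gq. Qed.

Lemma regularB f g : regular f -> regular g -> regular (fun x => f x - g x).
Proof. by move=> [p fp] [q gq]; exists (p - q) => x; rewrite mevalB fp gq. Qed.

Lemma regular_sum (I : Type) (r : seq I) (P : pred I) (F : I -> T -> k) :
  (forall i, regular (F i)) -> regular (fun x => \sum_(i <- r | P i) F i x).
Proof.
move=> FP; elim: r => [|i r IHr].
  by under eq_fun do rewrite big_nil; exact: regular_cst.
under eq_fun do rewrite big_cons; case: (P i) => //; exact: regularD.
Qed.

Lemma regular_prod (I : Type) (r : seq I) (P : pred I) (F : I -> T -> k) :
  (forall i, regular (F i)) -> regular (fun x => \prod_(i <- r | P i) F i x).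
Proof.
move=> FP; elim: r => [|i r IHr].
  by under eq_fun do rewrite big_nil; exact: regular_cst.
under eq_fun do rewrite big_cons; case: (P i) => //; exact: regularM.
Qed.

Lemma regular_meval m (v : T -> 'I_m -> k) (p : mpoly m k) :
  (forall i, regular (v ^~ i)) -> regular (fun x => meval (v x) p).
Proof. exact: (meval_closed regular_cst regularD regularM). Qed.

Definition zclosure Z : set T :=
  [set x | forall f, regular f -> (forall y, Z y -> f y = 0) -> f x = 0].

Definition zclosed Z := zclosure Z `<=` Z.

Lemma sub_zclosure Z : Z `<=` zclosure Z.
Proof. by move=> x Zx f _; exact. Qed.

Lemma zclosureS Y Z : Y `<=` Z -> zclosure Y `<=` zclosure Z.
Proof. by move=> YZ x Yx f rf Zf; apply: Yx => // y /YZ; exact: Zf. Qed.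

Lemma zclosed_zclosure Z : zclosed (zclosure Z).
Proof. by move=> x Zx f rf Zf; apply: Zx => // y; exact. Qed.

Lemma zclosedE Z : zclosed Z -> zclosure Z = Z.
Proof. by move=> Zc; apply/seteqP; split=> //; exact: sub_zclosure. Qed.

Lemma zclosedI Y Z : zclosed Y -> zclosed Z -> zclosed (Y `&` Z).
Proof.
by move=> Yc Zc x YZx; split; [apply: Yc|apply: Zc]; move: x YZx; apply: zclosureS => x [].
Qed.

Lemma zclosed_bigcap (I : Type) (P : set I) (F : I -> set T) :
  (forall i, P i -> zclosed (F i)) -> zclosed (\bigcap_(i in P) F i).
Proof.
move=> Fc x Fx i Pi; apply: Fc => //; move: x Fx; apply: zclosureS => x; exact.
Qed.

Lemma zclosed_zero f : regular f -> zclosed [set x | f x = 0].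
Proof. by move=> rf x; exact. Qed.

Lemma zclosed_eq f g : regular f -> regular g -> zclosed [set x | f x = g x].
Proof.
move=> rf rg x xfg; apply/eqP; rewrite -subr_eq0; apply/eqP.
by apply: (xfg (fun x => f x - g x)) => [|y /= ->]; [exact: regularB|rewrite subrr].
Qed.

Lemma zclosedU Y Z : zclosed Y -> zclosed Z -> zclosed (Y `|` Z).
Proof.
move=> Yc Zc x YZx; apply: contrapT => /not_orP[Yx Zx].
have /existsNP[f /not_implyP[rf /not_implyP[Yf fx]]] : ~ zclosure Y x by move/Yc.
have /existsNP[g /not_implyP[rg /not_implyP[Zg gx]]] : ~ zclosure Z x by move/Zc.
suff /eqP : f x * g x = 0 by rewrite mulf_eq0 => /orP[] /eqP.
by apply: (YZx _ (regularM rf rg)) => y [/Yf|/Zg] ->; rewrite ?mul0r ?mulr0.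
Qed.

Lemma zclosed_set0 : zclosed set0.
Proof.
move=> x x0; have /eqP : (1 : k) = 0 by apply: (x0 _ (regular_cst 1)).
by rewrite oner_eq0.
Qed.

(** Descending chain condition: without a minimal member there is a strictly decreasing sequence [F]
    of closed sets, which the Noetherian property forbids. *)
Lemma zclosed_min (P : set (set T)) : P !=set0 -> (forall Z, P Z -> zclosed Z) ->
  exists2 Z, P Z & forall W, P W -> W `<=` Z -> W = Z.
Proof.
move=> [Z0 PZ0] Pc; apply: contrapT => nmin.
have next Z : exists W, P Z -> [/\ P W, W `<=` Z & W <> Z].
  have [PZ|] := pselect (P Z); last by exists Z.
  apply: contrapT => nW; apply: nmin; exists Z => // W PW WZ.
  by apply: contrapT => W_Z; apply: nW; exists W.
have {next} [next nextP] := choice next.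
pose F j := iter j next Z0.
have PF j : P (F j) by elim: j => //= j /nextP[].
have F_sub i j : (i <= j)%N -> F j `<=` F i.
  move=> /subnK <-; elim: (j - i)%N => // d IHd x.
  by rewrite addSn => /(let: And3 _ h _ := nextP _ (PF _) in h); exact: IHd.
(* The union of the increasing vanishing ideals of the [F j]. Its finitely many generators all
   vanish on one [F m], which forces [F m.+1 = F m]. *)
pose S : set (mpoly n k) := [set p | exists j, forall x, F j x -> meval (c x) p = 0].
have [s sS Ss] := noetherian_mpoly (k := k) S.
have [m ms] : exists m, forall p, p \in s -> forall x, F m x -> meval (c x) p = 0.
  elim: s sS {Ss} => [|p s IHs] sS; first by exists 0%N.
  have [|m ms] := IHs; first by move=> q qs; apply: sS; rewrite inE qs orbT.
  have [j jp] := sS p (mem_head _ _).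
  exists (maxn j m) => q; rewrite inE => /orP[/eqP-> x Fx|/ms sq x Fx].
    by apply: jp; apply: F_sub Fx; rewrite leq_maxl.
  by apply: sq; apply: F_sub Fx; rewrite leq_maxr.
have [_ nF] := nextP _ (PF m); apply; apply/seteqP; split=> // x Fx.
apply: (Pc _ (PF m.+1)) => f [p fp] Fp; rewrite fp.
have [t ts ->] : ideal_gen [set` s] p.
  by apply: Ss; exists m.+1 => y /Fp <-.
rewrite rmorph_sum big_seq big1 // => y /ts ys /=.
by rewrite mevalM (ms _ ys) ?mulr0.
Qed.

(** The regular functions restricted to [Y] form an integral domain. This makes sense for arbitrary
    subsets, so images can be treated before taking closures. *)
Definition irreducible Y := Y !=set0 /\ forall f g, regular f -> regular g ->
  (forall x, Y x -> f x * g x = 0) ->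
  (forall x, Y x -> f x = 0) \/ (forall x, Y x -> g x = 0).

Lemma irreducible_zclosure Y : irreducible Y -> irreducible (zclosure Y).
Proof.
move=> [[y Yy] Yirr]; split; first by exists y; exact: sub_zclosure.
move=> f g rf rg fg.
have [|f0|g0] := Yirr f g rf rg; first by move=> x /(@sub_zclosure Y); exact: fg.
  by left=> x; apply.
by right=> x; apply.
Qed.

Lemma irreducible_subU Y Z1 Z2 : irreducible Y -> zclosed Z1 -> zclosed Z2 ->
  Y `<=` Z1 `|` Z2 -> Y `<=` Z1 \/ Y `<=` Z2.
Proof.
move=> [_ Yirr] Z1c Z2c YZ; apply: contrapT => /not_orP[].
move=> /existsNP[y1 /not_implyP[Yy1 /(contra_not (@Z1c _))]].
move=> /existsNP[f /not_implyP[rf /not_implyP[Zf fy]]].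
move=> /existsNP[y2 /not_implyP[Yy2 /(contra_not (@Z2c _))]].
move=> /existsNP[g /not_implyP[rg /not_implyP[Zg gy]]].
have [|f0|g0] := Yirr f g rf rg.
- by move=> x /YZ[/Zf|/Zg] ->; rewrite ?mul0r ?mulr0.
- exact/fy/f0.
- exact/gy/g0.
Qed.

(** The product of the [f x - b] over the list vanishes on [Y], so by irreducibility one factor
    does. *)
Lemma irreducible_finite_range Y f (s : seq k) : irreducible Y -> regular f ->
  (forall x, Y x -> f x \in s) -> forall x y, Y x -> Y y -> f x = f y.
Proof.
move=> [[y0 _] Yirr] rf fs.
have [a fa] : exists a, forall x, Y x -> f x = a.
  elim: s fs => [fs|a s IHs fs]; first by exists 0 => x /fs.
  have [| | |fs'|fa] := Yirr (fun x => \prod_(b <- s) (f x - b)) (fun x => f x - a).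
  - by apply: regular_prod => b; apply: regularB => //; exact: regular_cst.
  - by apply: regularB; last exact: regular_cst.
  - move=> x /fs; rewrite inE => /orP[/eqP->|xs]; first by rewrite subrr mulr0.
    by rewrite (big_rem _ xs) /= subrr !mul0r.
  - apply: IHs => x /fs' /eqP; rewrite prodf_seq_eq0 => /hasP[b bs /=].
    by rewrite subr_eq0 => /eqP ->.
  - by exists a => x /fa /eqP; rewrite subr_eq0 => /eqP.
by move=> x y /fa -> /fa ->.
Qed.

(** Noetherian induction: a minimal closed set without decomposition is reducible, hence the union
    of two proper closed subsets, which have decompositions. *)
Lemma irreducible_decomposition Z : zclosed Z ->
  exists m (Y : 'I_m -> set T), (forall i, irreducible (Y i) /\ Y i `<=` Z) /\
    forall x, Z x -> exists i, Y i x.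
Proof.
pose good W := exists m (Y : 'I_m -> set T),
  (forall i, irreducible (Y i) /\ Y i `<=` W) /\ forall x, W x -> exists i, Y i x.
move=> Zc; apply: contrapT => nZ.
have [|W []//|W [Wc nW] Wmin] := @zclosed_min [set W | zclosed W /\ ~ good W].
  by exists Z.
apply: nW; have [W0|W0] := pselect (W !=set0); last first.
  exists 0%N, (fun=> set0); split=> [[]//|x Wx]; exfalso; apply: W0; by exists x.
have [Wirr|/not_andP[//|]] := pselect (irreducible W).
  by exists 1%N, (fun=> W); split=> [i|x Wx]; [split|exists ord0].
move=> /existsNP[f /existsNP[g /not_implyP[rf /not_implyP[rg /not_implyP[fg]]]]].
move=> /not_orP[nf ng].
have part h : regular h -> ~ (forall x, W x -> h x = 0) -> good (W `&` [set x | h x = 0]).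
  move=> rh nh; apply: contrapT => nWh; apply: nh => x Wx.
  suff WhE : W `&` [set x | h x = 0] = W by move: Wx; rewrite -{1}WhE => -[].
  by apply: Wmin => [|y []//]; split=> //; apply: zclosedI => //; exact: zclosed_zero.
have [m1 [Y1 [Y1irr WY1]]] := part f rf nf.
have [m2 [Y2 [Y2irr WY2]]] := part g rg ng.
exists (m1 + m2)%N, (fun i => match fintype.split i with inl j => Y1 j | inr j => Y2 j end).
split=> [i|x Wx].
  case: fintype.split => j; [have [Yi YW] := Y1irr j|have [Yi YW] := Y2irr j]; split=> //;
  by move=> x /YW[].
have /eqP := fg x Wx; rewrite mulf_eq0 => /orP[/eqP fx|/eqP gx].
  by have [i Yx] := WY1 x (conj Wx fx); exists (lshift m2 i); rewrite (unsplitK (inl i)).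
by have [i Yx] := WY2 x (conj Wx gx); exists (rshift m1 i); rewrite (unsplitK (inr i)).
Qed.

End Zariski.

Section RegularMap.
Variables (k : fieldType) (T T' : Type) (n n' : nat).
Variables (c : T -> 'I_n -> k) (c' : T' -> 'I_n' -> k) (F : T -> T').
Hypothesis rF : forall i, regular c (fun x => c' (F x) i).

Lemma regular_comp f : regular c' f -> regular c (fun x => f (F x)).
Proof.
move=> [p fp]; under eq_fun do rewrite fp; exact: regular_meval.
Qed.

Lemma zclosed_preimage Z : zclosed c' Z -> zclosed c (F @^-1` Z).
Proof.
move=> Zc x Fx; apply: Zc => f rf Zf; apply: (Fx _ (regular_comp rf)) => y; exact: Zf.
Qed.

Lemma irreducible_image Y : irreducible c Y -> irreducible c' (F @` Y).
Proof.
move=> [[y Yy] Yirr]; split; first by exists (F y); exists y.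
move=> f g rf rg fg.
have [|f0|g0] := Yirr _ _ (regular_comp rf) (regular_comp rg).
- by move=> x Yx; apply: fg; exists x.
- by left=> _ [x Yx <-]; exact: f0.
- by right=> _ [x Yx <-]; exact: g0.
Qed.

End RegularMap.

(** * Quantifier elimination *)

Section QuantifierElimination.
Variable k : closedFieldType.

Lemma term_of_mpoly n (off : nat) (p : mpoly n k) :
  exists2 t : GRing.term k, GRing.rterm t &
    forall e, GRing.eval e t = meval (fun i => e`_(off + i)) p.
Proof.
elim/mpoly_subring_ind: p => [a|i|p q [t rt te] [u ru ue]|p q [t rt te] [u ru ue]].
- by exists (GRing.Const a) => // e; rewrite mevalC.
- by exists (GRing.Var k (off + i)) => // e; rewrite mevalXU.
- by exists (GRing.Add t u) => [|e]; rewrite /= ?rt // mevalD te ue.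
- by exists (GRing.Mul t u) => [|e]; rewrite /= ?rt // mevalM te ue.
Qed.

Definition env m (z : 'I_m -> k) : seq k := [seq z i | i <- enum 'I_m].

Lemma size_env m (z : 'I_m -> k) : size (env z) = m.
Proof. by rewrite size_map size_enum_ord. Qed.

Lemma nth_env m (z : 'I_m -> k) (i : 'I_m) : (env z)`_i = z i.
Proof. by rewrite (nth_map i) ?nth_ord_enum // size_enum_ord. Qed.

Lemma eval_env_regular m (t : GRing.term k) : GRing.rterm t ->
  regular (fun z : 'I_m -> k => z) (fun z => GRing.eval (env z) t).
Proof.
elim: t => //=.
- move=> i _; have [im|mi] := ltnP i m.
    suff -> : (fun z => (env z)`_i) = (fun z : 'I_m -> k => z (Ordinal im)).
      exact: regular_coord.
    by apply: funext => z; rewrite -nth_env.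
  suff -> : (fun z => (env z)`_i) = (fun z : 'I_m -> k => 0) by exact: regular_cst.
  by apply: funext => z; rewrite nth_default ?size_env.
- by move=> a _; exact: regular_cst.
- by move=> a _; exact: regular_cst.
- by move=> t IHt u IHu /andP[/IHt rt /IHu ru]; exact: regularD.
- move=> t IHt /IHt rt; rewrite (_ : (fun z => _) = (fun z => 0 - GRing.eval (env z) t)).
    by apply: regularB => //; exact: regular_cst.
  by apply: funext => z; rewrite sub0r.
- move=> t IHt d /IHt rt; rewrite (_ : (fun z => _) = (fun z => GRing.eval (env z) t * d%:R)).
    by apply: regularM => //; exact: regular_cst.
  by apply: funext => z; rewrite mulr_natr.
- by move=> t IHt u IHu /andP[/IHt rt /IHu ru]; exact: regularM.
- move=> t IHt d /IHt rt.
  rewrite (_ : (fun z => _) = (fun z => \prod_(i < d) GRing.eval (env z) t)).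
    exact: regular_prod.
  by apply: funext => z; rewrite prodr_const card_ord.
Qed.

(* The form in which constructibility of [E] is used; it is visibly stable under
   Boolean operations. *)
Definition generically_decided m (E : set ('I_m -> k)) :=
  forall Y, irreducible (fun z : 'I_m -> k => z) Y ->
  exists q, [/\ regular (fun z : 'I_m -> k => z) q, exists2 y, Y y & q y != 0 &
    (forall y, Y y -> q y != 0 -> E y) \/ (forall y, Y y -> q y != 0 -> ~ E y)].

Lemma generically_decidedC m (E : set ('I_m -> k)) :
  generically_decided E -> generically_decided (~` E).
Proof.
move=> Ed Y /Ed[q [rq Yq [qE|qE]]]; exists q; split=> //; [right|left] => // y Yy qy.
by apply; exact: qE.
Qed.

Lemma generically_decidedI m (E1 E2 : set ('I_m -> k)) :
  generically_decided E1 -> generically_decided E2 -> generically_decided (E1 `&` E2).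
Proof.
move=> E1d E2d Y Yirr.
have [q1 [rq1 Yq1 []q1E]] := E1d Y Yirr; last first.
  by exists q1; split=> //; right=> y Yy /q1E - /(_ Yy) nE1 [].
have [q2 [rq2 Yq2 []q2E]] := E2d Y Yirr; last first.
  by exists q2; split=> //; right=> y Yy /q2E - /(_ Yy) nE2 [].
exists (fun z => q1 z * q2 z); split; first exact: regularM.
  apply: contrapT => n12.
  have [|Y1|Y2] := Yirr.2 _ _ rq1 rq2.
  - by move=> y Yy; apply/eqP; apply: contrapT => /negP q12; apply: n12; exists y.
  - by have [y /Y1 ->] := Yq1; rewrite eqxx.
  - by have [y /Y2 ->] := Yq2; rewrite eqxx.
left=> y Yy; rewrite mulf_eq0 negb_or => /andP[q1y q2y].
by split; [exact: q1E|exact: q2E].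
Qed.

(** By induction on the formula. For an equation, the difference of the two sides either vanishes on
    all of [Y] or serves as [q]. *)
Lemma generically_decided_qf m (f : GRing.formula k) :
  GRing.qf_form f -> GRing.rformula f ->
  generically_decided [set z : 'I_m -> k | GRing.qf_eval (env z) f].
Proof.
have decC (g : ('I_m -> k) -> bool) : generically_decided [set z | g z] ->
    generically_decided [set z | ~~ g z].
  move=> /generically_decidedC; congr generically_decided.
  by apply/seteqP; split=> z /= /negP.
have decI (g h : ('I_m -> k) -> bool) : generically_decided [set z | g z] ->
    generically_decided [set z | h z] -> generically_decided [set z | g z && h z].
  move=> gd hd; have := generically_decidedI gd hd; congr generically_decided.
  by apply/seteqP; split=> z /= /andP.
have decU (g h : ('I_m -> k) -> bool) : generically_decided [set z | g z] ->
    generically_decided [set z | h z] -> generically_decided [set z | g z || h z].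
  move=> gd hd; have := decC _ (decI _ _ (decC _ gd) (decC _ hd)).
  congr generically_decided; apply/seteqP; split=> z /=; by rewrite -negb_or negbK.
elim: f => //=.
- move=> b _ _ Y [[y Yy] _]; exists (fun=> 1); split; first exact: regular_cst.
    by exists y; rewrite ?oner_eq0.
  by case: b; [left|right].
- move=> t u _ /andP[/(@eval_env_regular m) rt /(@eval_env_regular m) ru] Y Yirr.
  have [tu|/existsNP[y /not_implyP[Yy /eqP tuy]]] :=
    pselect (forall z, Y z -> GRing.eval (env z) t = GRing.eval (env z) u).
    exists (fun=> 1); split; first exact: regular_cst.
      by have [[y Yy] _] := Yirr; exists y; rewrite ?oner_eq0.
    by left=> y Yy _; apply/eqP; exact: tu.
  exists (fun z => GRing.eval (env z) t - GRing.eval (env z) u).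
  split; [exact: regularB|by exists y; rewrite ?subr_eq0|].
  by right=> z _ /=; rewrite subr_eq0 => /negP.
- by move=> f IHf g IHg /andP[? ?] /andP[? ?]; apply: decI; [exact: IHf|exact: IHg].
- by move=> f IHf g IHg /andP[? ?] /andP[? ?]; apply: decU; [exact: IHf|exact: IHg].
- move=> f IHf g IHg /andP[? ?] /andP[? ?].
  have := decU _ _ (decC _ (IHf _ _)) (IHg _ _) => /(_ _ _ _ _)/wrap[]//.
  by congr generically_decided; apply/seteqP; split=> z /=; rewrite implybE.
- by move=> f IHf qf rf; apply/decC/IHf.
Qed.

(* Chevalley's theorem on the image of a closed set *)
Lemma generically_decided_image n m (S : set (mpoly n k)) (u : 'I_m -> mpoly n k) :
  generically_decided [set z | exists v, (forall p, S p -> meval v p = 0) /\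
                                         forall i, z i = meval v (u i)].
Proof.
have [s sS Ss] := noetherian_mpoly (k := k) S.
have [eq1 req1 eq1P] : exists2 f : GRing.formula k, GRing.rformula f & forall e,
    GRing.holds e f <-> forall p, p \in s -> meval (fun i => e`_(m + i)) p = 0.
  elim: s {sS Ss} => [|p s [f rf fP]]; first by exists (GRing.Bool true).
  have [t rt te] := term_of_mpoly m p.
  exists (GRing.And (GRing.Equal t (GRing.Const 0)) f) => [/=|e /=].
    by rewrite rt.
  rewrite te fP; split=> [[p0 s0] q|ps0].
    by rewrite inE => /orP[/eqP->|/s0].
  by split=> [|q qs]; apply: ps0; rewrite inE ?eqxx ?qs ?orbT.
have [eq2 req2 eq2P] : exists2 f : GRing.formula k, GRing.rformula f & forall e,
    GRing.holds e f <-> forall i, i \in enum 'I_m ->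
      e`_i = meval (fun i => e`_(m + i)) (u i).
  elim: (enum 'I_m) => [|i r [f rf fP]]; first by exists (GRing.Bool true).
  have [t rt te] := term_of_mpoly m (u i).
  exists (GRing.And (GRing.Equal (GRing.Var k i) t) f) => [/=|e /=].
    by rewrite rt.
  rewrite te fP; split=> [[p0 s0] q|ps0].
    by rewrite inE => /orP[/eqP->|/s0].
  by split=> [|q qs]; apply: ps0; rewrite inE ?eqxx ?qs ?orbT.
(* The variables below [m] stay free and hold the image point; those from [m] to [m + n - 1] hold
   the source point and are quantified. *)
pose f := foldr GRing.Exists (GRing.And eq1 eq2) (iota m n).
have rf : GRing.rformula f.
  by rewrite /f; elim: (iota m n) => //=; rewrite req1.
have cl := @GRing.solve_monicpoly k.
have wf := @ClosedFieldQE.wf_ex_elim k.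
have ok := @ClosedFieldQE.holds_ex_elim k cl.
have /andP[qq rq] := GRing.quantifier_elim_wf wf rf.
have := @generically_decided_qf m _ qq rq; congr generically_decided.
apply/seteqP; split=> z /=.
  move=> /(GRing.quantifier_elim_rformP wf ok _ rf) /GRing.foldExistsP[e ez].
  move=> /= [/eq1P es /eq2P eu]; exists (fun i => e`_(m + i)); split.
    move=> p /Ss[t ts ->]; rewrite rmorph_sum big_seq big1 // => x /ts xs.
    by rewrite rmorphM [X in _ * X](es _ xs) mulr0.
  move=> i; rewrite -eu ?mem_enum // -nth_env ez // inE mem_iota.
  by rewrite leqNgt ltn_ord.
move=> [v [vS zv]].
apply/(GRing.quantifier_elim_rformP wf ok _ rf)/GRing.foldExistsP.
have ve (i : 'I_n) : (env z ++ env v)`_(m + i) = v i.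
  by rewrite nth_cat size_env ltnNge leq_addr /= addKn nth_env.
exists (env z ++ env v) => [i|/=].
  rewrite inE mem_iota negb_and -ltnNge -leqNgt nth_cat size_env.
  move=> /orP[->//|mni].
  rewrite ifF; last by apply/negbTE; rewrite -leqNgt (leq_trans _ mni) ?leq_addr.
  rewrite !nth_default ?size_env ?leq_subRL //.
    by rewrite (leq_trans _ mni) ?leq_addr.
  by rewrite (leq_trans _ mni) ?leq_addr.
split; first by apply/eq1P => p /sS /vS {2}<-; apply: meval_eq.
apply/eq2P => i _; rewrite nth_cat size_env ltn_ord nth_env zv.
by apply: meval_eq => j; rewrite ve.
Qed.

End QuantifierElimination.

(** * Images of regular maps *)

Section Images.
Variables (k : closedFieldType) (T : Type) (n : nat) (c : T -> 'I_n -> k).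
Hypothesis c_inj : injective c.
Hypothesis c_closed : forall v,
  (forall p : mpoly n k, (forall x, meval (c x) p = 0) -> meval v p = 0) ->
  exists x, c x = v.
Implicit Types (X Y : set T) (f : T -> T) (s : T -> k).

(** By [c_closed], every common zero of the polynomials vanishing on [X] comes from a point of [X],
    so the image is that of a zero locus. *)
Lemma generically_decided_zimage X m (u : T -> 'I_m -> k) :
  zclosed c X -> (forall i, regular c (u ^~ i)) -> generically_decided (u @` X).
Proof.
move=> Xc ru; have [p up] := choice ru.
pose S := [set r : mpoly n k | forall x, X x -> meval (c x) r = 0].
rewrite (_ : u @` X = [set z | exists v, (forall r, S r -> meval v r = 0) /\
                                         forall i, z i = meval v (p i)]).
  exact: generically_decided_image.
apply/seteqP; split=> [_ [x Xx <-]|z [v [vS zv]]].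
  by exists (c x); split=> [r|i]; [exact|exact: up].
have [p0 p00|x xv] := c_closed (v := v); first by apply: vS => x _; exact: p00.
exists x; last by apply: funext => i; rewrite up xv zv.
by apply: Xc => h [r rE] Xr; rewrite rE xv; apply: vS => y Xy; rewrite -rE Xr.
Qed.

(** The generic decision on the closure cannot be negative, because [q] is nonzero at some point of
    the image itself. *)
Lemma image_contains_open X m (u : T -> 'I_m -> k) :
  zclosed c X -> irreducible c X -> (forall i, regular c (u ^~ i)) ->
  exists q, [/\ regular (fun z : 'I_m -> k => z) q, exists2 x, X x & q (u x) != 0 &
    forall y, zclosure (fun z => z) (u @` X) y -> q y != 0 -> (u @` X) y].
Proof.
move=> Xc Xirr ru.
have uXirr : irreducible (fun z : 'I_m -> k => z) (zclosure (fun z => z) (u @` X)).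
  by apply: irreducible_zclosure; exact: irreducible_image Xirr.
have [q [rq [y Xy qy] qP]] := generically_decided_zimage Xc ru uXirr.
have [x [Xx qx]] : exists x, X x /\ q (u x) != 0.
  apply: contrapT => /forallNP nq; move: qy; rewrite (Xy q rq) ?eqxx // => _ [x Xx <-].
  by apply/eqP; apply: contrapT => /negP qx; apply: (nq x).
exists q; split=> //; first by exists x.
case: qP => // qP; have uXx : (u @` X) (u x) by exists x.
by case: (qP (u x)) => //; exact: sub_zclosure.
Qed.

Definition ext (z : 'I_n -> k) (t : k) (i : 'I_n.+1) : k :=
  if unlift ord0 i is Some j then z j else t.

Lemma meval_ext (p : mpoly n.+1 k) : exists Q : {poly mpoly n k},
  forall z t, meval (ext z t) p = (map_poly (meval z) Q).[t].
Proof.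
elim/mpoly_subring_ind: p => [a|i|p q [P PE] [Q QE]|p q [P PE] [Q QE]].
- by exists (mpolyC n a)%:P => z t; rewrite map_polyC hornerC /= !mevalC.
- have [j ->|->] := unliftP ord0 i.
    exists (mpolyX k (mnm1 j))%:P => z t.
    by rewrite map_polyC hornerC /= !mevalXU /ext liftK.
  by exists 'X => z t; rewrite map_polyX hornerX mevalXU /ext unlift_none.
- by exists (P + Q) => z t; rewrite mevalD rmorphD hornerD PE QE.
- by exists (P * Q) => z t; rewrite mevalM rmorphM hornerM PE QE.
Qed.

Lemma horner_regular m (u : T -> 'I_m -> k) s (Q : {poly mpoly m k}) :
  (forall i, regular c (u ^~ i)) -> regular c s ->
  regular c (fun x => (map_poly (meval (u x)) Q).[s x]).
Proof.
move=> ru rs.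
rewrite (_ : (fun x => _) =
    (fun x => \sum_(i < size Q) meval (u x) Q`_i * \prod_(j < i) s x)).
  by apply: regular_sum => i; apply: regularM; [exact: regular_meval|exact: regular_prod].
apply: funext => x; rewrite (horner_coef_wide _ (size_poly _ _)).
by apply: eq_bigr => i _; rewrite coef_map prodr_const card_ord.
Qed.

Section FiniteFibres.
Variable f : T -> T.
Hypothesis rf : forall i, regular c (fun x => c (f x) i).

Lemma finite_fibres_algebraic X s : zclosed c X -> irreducible c X -> regular c s ->
  (forall x, X x -> finite_set [set y | X y /\ f y = f x]) ->
  exists Q : {poly mpoly n k},
    (forall x, X x -> (map_poly (meval (c (f x))) Q).[s x] = 0) /\
    exists x j, X x /\ meval (c (f x)) Q`_j != 0.
Proof.
move=> Xc Xirr rs fin; apply: contrapT => nalg.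
pose u x := ext (c (f x)) (s x).
have ru i : regular c (u ^~ i) by rewrite /u /ext; case: (unlift ord0 i).
have [q [[qp qpE] [x Xx qx] qP]] := image_contains_open Xc Xirr ru.
(* An equation of the image of [u] not vanishing at this point would be a relation [Q] with a
   nonzero coefficient at [f x]. *)
have cyl t : zclosure (fun z => z) (u @` X) (ext (c (f x)) t).
  move=> h [p pE] Xp; apply/eqP; apply: contrapT => /negP; rewrite pE => px.
  apply: nalg; have [Q QE] := meval_ext p; exists Q; split=> [y Xy|].
    by rewrite -QE -pE Xp //; exists y.
  apply: contrapT => nj; move: px; rewrite QE.
  rewrite (_ : map_poly _ Q = 0) ?horner0 ?eqxx //; apply/polyP => j.
  rewrite coef_map coef0; apply/eqP; apply: contrapT => /negP Qj; apply: nj.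
  by exists x, j.
have [Q QE] := meval_ext qp.
pose R := map_poly (meval (c (f x))) Q.
have R0 : R != 0.
  by apply: contraNneq qx => R0; rewrite qpE QE -/R R0 horner0.
pose F := [set y | X y /\ f y = f x].
have : finite_set ((s @` F) `|` [set t | root R t]).
  rewrite finite_setU; split; first exact/finite_image/fin.
  have [rs' rsE] := closed_field_poly_normal R.
  apply: (@sub_finite_set _ _ [set` rs']) => [t /=|]; last exact: finite_seq.
  by rewrite rsE rootZ ?lead_coef_eq0 // root_prod_XsubC.
(* Any [t] that is not a root of [R] gives a point over [f x] in the image of [u], so [t] is a value
   of [s] on the fibre. But [k] is infinite. *)
suff -> : (s @` F) `|` [set t | root R t] = setT.
  move=> /finite_seqP[l lE].
  have /closed_nonrootP[t] := monic_neq0 (monic_prod_XsubC l xpredT id).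
  rewrite root_prod_XsubC => /negP; apply.
  by have : [set` l] t by rewrite -lE.
apply/seteqP; split=> // t _; have [Rt|Rt] := boolP (root R t); first by right.
left; have [||y Xy yE] := qP (ext (c (f x)) t) => //.
  by rewrite qpE QE.
exists y; last by have := congr1 (@^~ ord0) yE; rewrite /u /ext unlift_none.
split=> //; apply: c_inj; apply: funext => i.
by have := congr1 (@^~ (lift ord0 i)) yE; rewrite /u /ext liftK.
Qed.

(* Otherwise the closures of the iterated images of [X] strictly decrease up to some
   [Y], and then stabilise at [Z = zclosure (f @` Y)]. A function [a] that
   vanishes on [Z] but not on [Y] is algebraic over the functions [b \o f].
   Dividing a relation by a power of [a] makes its constant coefficient nonzero on [f @` Y];
   but that coefficient vanishes on [f @` Z], hence on [Z], which contains [f @` Y]. *)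
Lemma finite_fibres_dominant X : zclosed c X -> irreducible c X -> f @` X `<=` X ->
  (forall x, X x -> finite_set [set y | X y /\ f y = f x]) ->
  X `<=` zclosure c (f @` X).
Proof.
move=> Xc Xirr fX fin.
pose Z j := iter j (fun Y => zclosure c (f @` Y)) X.
have Zc j : zclosed c (Z j) by case: j => //= j; exact: zclosed_zclosure.
have Zirr j : irreducible c (Z j).
  by elim: j => //= j IHj; apply/irreducible_zclosure/irreducible_image.
have ZS j : Z j.+1 `<=` Z j.
  elim: j => [|j IHj]; first by rewrite -[X in _ `<=` X](zclosedE (Zc _)); exact: zclosureS.
  by apply: zclosureS => _ [x /IHj Zx <-]; exists x.
have ZX j : Z j `<=` X by elim: j => // j IHj x /ZS; exact: IHj.
have exm : exists m, `[< Z m.+1 = Z m >].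
  have [||_ [m _ <-] Zmin] := @zclosed_min _ _ _ c (range Z).
  - by exists X; exists 0%N.
  - by move=> _ [j _ <-].
  by exists m; apply/asboolP/Zmin => //; exists m.+1.
case: (ex_minnP exm) => -[|m] /asboolP Zm mmin; first by rewrite -[X in X `<=` _]Zm.
exfalso; have : Z m.+1 <> Z m by move/asboolP/mmin; rewrite ltnn.
apply; apply/seteqP; split=> //.
apply: contrapT => /existsNP[y /not_implyP[Zy /(contra_not (@Zc m.+1 y))]].
move=> /existsNP[a /not_implyP[ra /not_implyP[Za ay]]].
have [|Q [Qa [x0 [j0 [Zx0 Qj0]]]]] := finite_fibres_algebraic (Zc m) (Zirr m) ra.
  move=> x /ZX /fin; apply: sub_finite_set => z [/ZX Xz fz]; by split.
have exj : exists j, `[< exists2 x, Z m x & meval (c (f x)) Q`_j != 0 >].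
  by exists j0; apply/asboolP; exists x0.
case: (ex_minnP exj) => j /asboolP[x Zx Qj] jmin.
have Qlow i y' : (i < j)%N -> Z m y' -> meval (c (f y')) Q`_i = 0.
  move=> ij Zy'; apply/eqP; apply: contrapT => /negP Qi.
  by move: ij; rewrite ltnNge jmin //; apply/asboolP; exists y'.
pose h z := (map_poly (meval (c (f z))) (drop_poly j Q)).[a z].
have rh : regular c h by exact: horner_regular.
have [| | |h0|/(_ y Zy)/eqP] :=
    (Zirr m).2 h (fun z => \prod_(i < j) a z).
- by [].
- exact: regular_prod.
(* The coefficients of [Q] below [j] vanish on the image of [Z m], so the relation reads
   [h z * a z ^+ j = 0]. *)
- move=> z Zz; rewrite prodr_const card_ord; have := Qa z Zz.
  rewrite -[Q in map_poly _ Q](poly_take_drop j) rmorphD rmorphM /= map_polyXn.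
  rewrite hornerD hornerM hornerXn (_ : map_poly _ (take_poly j Q) = 0).
    by rewrite horner0 add0r.
  apply/polyP => i; rewrite coef_map coef0 coef_take_poly.
  by case: ifP => [ij|_]; [exact: Qlow|exact: raddf0].
- suff Qf z : Z m.+1 z -> meval (c z) Q`_j = 0.
    by move: Qj; rewrite Qf ?eqxx //; apply: sub_zclosure; exists x.
  rewrite -Zm; move=> /(_ (fun z => meval (c z) Q`_j)); apply.
    by exists Q`_j.
  move=> _ [w Zw <-]; have := h0 w (ZS _ _ Zw).
  rewrite /h (Za w) ?horner_coef0 ?coef_map ?coef_drop_poly //.
- by rewrite prodr_const card_ord expf_eq0 => /andP[_ /eqP].
Qed.

End FiniteFibres.
End Images.

(** * The identity component *)

Lemma zclosed_bigcup_ord (k : fieldType) (T : Type) n (c : T -> 'I_n -> k) m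
  (F : 'I_m -> set T) : (forall i, zclosed c (F i)) -> zclosed c (\bigcup_i F i).
Proof.
elim: m F => [|m IHm] F Fc.
  rewrite (_ : \bigcup_i F i = set0); first exact: zclosed_set0.
  by apply/seteqP; split=> // x [[]].
rewrite (_ : \bigcup_i F i = F ord0 `|` \bigcup_i F (lift ord0 i)).
  by apply: zclosedU => //; exact: IHm.
apply/seteqP; split=> x.
  by move=> [i _]; have [j ->|->] := unliftP ord0 i => Fx; [right; exists j|left].
by move=> [Fx|[j _ Fx]]; [exists ord0|exists (lift ord0 j)].
Qed.

Section AlgebraicGroup.
Variables (k : closedFieldType) (G : groupType) (A : affine_algebraic_group k G).
Implicit Types Y Z : set G.

Definition gcoord (x : G) (i : 'I_(adim A)) : k := (affine_coord A x : 'rV[k]_(adim A)) ord0 i.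

Lemma gcoord_inj : injective gcoord.
Proof.
move=> x y xy; apply: (affine_coord_inj (a := A)); apply/rowP => i.
by have := congr1 (@^~ i) xy.
Qed.

Lemma gcoord_closed (v : 'I_(adim A) -> k) :
  (forall p : mpoly (adim A) k, (forall x, meval (gcoord x) p = 0) -> meval v p = 0) ->
  exists x, gcoord x = v.
Proof.
move=> v0; have [S AS] := (zariski_closedP _).1 (@affine_coord_closed _ _ A).
have : range (affine_coord A) (\row_i v i : 'rV_ _).
  rewrite AS => p Sp; rewrite (@meval_eq _ _ _ v); last by move=> i; rewrite mxE.
  apply: v0 => x; have : range (affine_coord A) (affine_coord A x) by exists x.
  by rewrite AS => /(_ p Sp).
by move=> [x _ xv]; exists x; apply: funext => i; rewrite /gcoord xv mxE.
Qed.

Section CoordClosure.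
Variables (X : Type) (P : (X -> k) -> Prop).
Hypothesis PC : forall a, P (fun=> a).
Hypothesis PD : forall f g, P f -> P g -> P (fun x => f x + g x).
Hypothesis PM : forall f g, P f -> P g -> P (fun x => f x * g x).

(** The group law is polynomial in the coordinates, so it preserves any class of functions with
    constants, sums and products. *)
Lemma gcoord_mul_closed (F1 F2 : X -> G) :
  (forall i, P (fun x => gcoord (F1 x) i)) -> (forall i, P (fun x => gcoord (F2 x) i)) ->
  forall i, P (fun x => gcoord (F1 x * F2 x)%g i).
Proof.
move=> P1 P2 i; have [p mulE] := mul_regular A.
under eq_fun do rewrite /gcoord mulE mxE.
apply: (meval_closed PC PD PM) => j.
rewrite -(splitK j); case: (fintype.split j) => l.
  by under eq_fun do rewrite row_mxEl; exact: P1.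
by under eq_fun do rewrite row_mxEr; exact: P2.
Qed.

Lemma gcoord_inv_closed (F : X -> G) :
  (forall i, P (fun x => gcoord (F x) i)) -> forall i, P (fun x => gcoord (F x)^-1%g i).
Proof.
move=> PF i; have [p invE] := inv_regular A.
under eq_fun do rewrite /gcoord invE mxE.
by apply: (meval_closed PC PD PM) => j; exact: PF.
Qed.

Lemma gcoord_exp_closed (F : X -> G) m :
  (forall i, P (fun x => gcoord (F x) i)) -> forall i, P (fun x => gcoord (F x ^+ m)%g i).
Proof.
move=> PF; elim: m => [|m IHm] i; first by under eq_fun do rewrite expg0; exact: PC.
by under eq_fun do rewrite expgS; exact: gcoord_mul_closed.
Qed.

End CoordClosure.

Definition regular_map (F : G -> G) := forall i, regular gcoord (fun x => gcoord (F x) i).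

Lemma regular_map_id : regular_map id.
Proof. by move=> i; exact: regular_coord. Qed.

Lemma regular_map_cst (g : G) : regular_map (fun=> g).
Proof. by move=> i; exact: regular_cst. Qed.

Lemma regular_map_mul F1 F2 : regular_map F1 -> regular_map F2 ->
  regular_map (fun x => F1 x * F2 x)%g.
Proof.
by apply: gcoord_mul_closed; [exact: regular_cst|exact: regularD|exact: regularM].
Qed.

Lemma regular_map_inv F : regular_map F -> regular_map (fun x => (F x)^-1)%g.
Proof.
by apply: gcoord_inv_closed; [exact: regular_cst|exact: regularD|exact: regularM].
Qed.

Lemma regular_map_exp F m : regular_map F -> regular_map (fun x => F x ^+ m)%g.
Proof.
by apply: gcoord_exp_closed; [exact: regular_cst|exact: regularD|exact: regularM].
Qed.

Lemma regular_map_mull (g : G) : regular_map (fun x => g * x)%g.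
Proof. by apply: regular_map_mul; [exact: regular_map_cst|exact: regular_map_id]. Qed.

Lemma regular_map_mulr (g : G) : regular_map (fun x => x * g)%g.
Proof. by apply: regular_map_mul; [exact: regular_map_id|exact: regular_map_cst]. Qed.

Lemma zclosed_equalizer F1 F2 : regular_map F1 -> regular_map F2 ->
  zclosed gcoord [set x | F1 x = F2 x].
Proof.
move=> r1 r2.
rewrite (_ : [set x | _] = \bigcap_i [set x | gcoord (F1 x) i = gcoord (F2 x) i]).
  by apply: zclosed_bigcap => i _; exact: zclosed_eq.
apply/seteqP; split=> x /=; first by move=> F12 i _ /=; rewrite F12.
by move=> F12; apply/gcoord_inj/funext => i; exact: (F12 i I).
Qed.

(** For each fixed [y], irreducibility of [Z] makes [f] or [g] vanish on the translate of [Z] by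
    [y]. Hence the product of [f (y * z1)] and [g (y * z2)] vanishes on [Y], and irreducibility of
    [Y] applies. *)
Lemma irreducible_mulg Y Z : irreducible gcoord Y -> irreducible gcoord Z ->
  irreducible gcoord [set x | exists y z, [/\ Y y, Z z & x = (y * z)%g]].
Proof.
move=> [[y0 Yy0] Yirr] [[z0 Zz0] Zirr]; split; first by exists (y0 * z0)%g, y0, z0.
move=> f g rf rg fg; apply: contrapT => /not_orP[].
move=> /existsNP[_ /not_implyP[[y1 [z1 [Yy1 Zz1 ->]]] f1]].
move=> /existsNP[_ /not_implyP[[y2 [z2 [Yy2 Zz2 ->]]] g2]].
have [| | |f0|g0] := Yirr (fun y => f (y * z1)%g) (fun y => g (y * z2)%g).
- exact: regular_comp (regular_map_mulr z1) _ rf.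
- exact: regular_comp (regular_map_mulr z2) _ rg.
- move=> y Yy; have [| | |fy|gy] := Zirr (fun z => f (y * z)%g) (fun z => g (y * z)%g).
  + exact: regular_comp (regular_map_mull y) _ rf.
  + exact: regular_comp (regular_map_mull y) _ rg.
  + by move=> z Zz; apply: fg; exists y, z.
  + by rewrite fy ?mul0r.
  + by rewrite gy ?mulr0.
- exact/f1/f0.
- exact/g2/g0.
Qed.

(** The union of all irreducible sets through 1, an algebraic description of the identity
    component. *)
Definition irreducible_component1 : set G :=
  [set x | exists Y, [/\ irreducible gcoord Y, Y 1%g & Y x]].

Local Notation G0 := irreducible_component1.

Lemma sub_irreducible_component1 Y : irreducible gcoord Y -> Y 1%g -> Y `<=` G0.
Proof. by move=> Yirr Y1 x Yx; exists Y. Qed.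

Lemma irreducible_component1_1 : G0 1%g.
Proof.
exists [set 1%g]; split=> //; split; first by exists 1%g.
move=> f g _ _ /(_ _ erefl)/eqP; rewrite mulf_eq0 => /orP[]/eqP fg.
  by left=> _ ->.
by right=> _ ->.
Qed.

(** Two irreducible sets through 1 both lie in their product, which is again irreducible and
    contains 1. *)
Lemma irreducible_component1_irr : irreducible gcoord G0.
Proof.
split; first by exists 1%g; exact: irreducible_component1_1.
move=> f g rf rg fg; apply: contrapT => /not_orP[].
move=> /existsNP[x /not_implyP[[Y [Yirr Y1 Yx]] fx]].
move=> /existsNP[y /not_implyP[[Z [Zirr Z1 Zy]] gy]].
have [_ YZirr] := irreducible_mulg Yirr Zirr.
have [|f0|g0] := YZirr f g rf rg.
- move=> z YZz; apply: fg; move: z YZz; apply: sub_irreducible_component1.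
    exact: irreducible_mulg.
  by exists 1%g, 1%g; rewrite mulg1.
- by apply/fx/f0; exists x, 1%g; rewrite mulg1.
- by apply/gy/g0; exists 1%g, y; rewrite mul1g.
Qed.

Lemma irreducible_component1_closed : zclosed gcoord G0.
Proof.
apply: sub_irreducible_component1.
  exact/irreducible_zclosure/irreducible_component1_irr.
exact/sub_zclosure/irreducible_component1_1.
Qed.

Lemma irreducible_component1_mul x y : G0 x -> G0 y -> G0 (x * y)%g.
Proof.
have irr0 := irreducible_component1_irr.
move=> x0 y0; apply: sub_irreducible_component1 (irreducible_mulg irr0 irr0) _ _ _.
  by exists 1%g, 1%g; rewrite mulg1; split=> //; exact: irreducible_component1_1.
by exists x, y.
Qed.

Lemma irreducible_component1_inv x : G0 x -> G0 x^-1%g.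
Proof.
have irrV := irreducible_image (regular_map_inv regular_map_id) irreducible_component1_irr.
move=> x0; apply: sub_irreducible_component1 irrV _ _ _; last by exists x.
by exists 1%g; [exact: irreducible_component1_1|exact: invg1].
Qed.

Lemma irreducible_component1_conj (g : G) x : G0 x -> G0 (g * x * g^-1)%g.
Proof.
have rJ : regular_map (fun x => g * x * g^-1)%g.
  by apply: regular_map_mul (regular_map_mull g) (regular_map_cst _).
have irrJ := irreducible_image rJ irreducible_component1_irr.
move=> x0; apply: sub_irreducible_component1 irrJ _ _ _; last by exists x.
by exists 1%g; [exact: irreducible_component1_1|rewrite mulg1 mulgV].
Qed.

Lemma irreducible_component1_conjV (g : G) x : G0 x -> G0 (g^-1 * x * g)%g.
Proof. by move=> /(irreducible_component1_conj g^-1%g); rewrite invgK. Qed.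

(** Each of the finitely many irreducible pieces of [G], translated to pass through 1, lies in [G0];
    so [G0] has finite index. *)
Lemma irreducible_component1_index :
  exists m (y : 'I_m -> G), forall x, exists i, G0 ((y i)^-1 * x)%g.
Proof.
have [//|m [Y [Yirr YT]]] := @irreducible_decomposition _ _ _ gcoord setT.
have [y Yy] := choice (fun i => (Yirr i).1.1).
exists m, y => x; have [i Yx] := YT x I; exists i.
have irrV := irreducible_image (regular_map_mull (y i)^-1%g) (Yirr i).1.
apply: sub_irreducible_component1 irrV _ _ _; last by exists x.
by exists (y i) => //; rewrite mulVg.
Qed.

(** By finiteness of the index, two powers of [g] lie in the same coset of [G0]. *)
Lemma irreducible_component1_expg (g : G) : exists2 m, (0 < m)%N & G0 (g ^+ m)%g.
Proof.
have [m [y yP]] := irreducible_component1_index.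
have [h hP] := choice (fun j => yP (g ^+ j)%g).
have /injectivePn[i [j ij hij]] : ~~ injectiveb (fun j : 'I_m.+1 => h j).
  by apply/negP => /injectiveP /leq_card; rewrite !card_ord ltnn.
wlog {ij} ij : i j hij / (i < j)%N.
  move=> wl; have := ij; rewrite neq_ltn => /orP[]; [exact: wl|].
  by apply: wl; rewrite hij.
exists (j - i)%N; first by rewrite subn_gt0.
have -> : (g ^+ (j - i) = ((y (h i))^-1 * g ^+ i)^-1 * ((y (h i))^-1 * g ^+ j))%g.
  rewrite invgM invgK -mulgA mulVKg; apply: (mulgI (g ^+ i)%g).
  by rewrite -expgnDr subnKC ?mulVKg ?(ltnW ij).
apply: irreducible_component1_mul; first exact/irreducible_component1_inv/hP.
by rewrite hij; exact: hP.
Qed.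

(** The complement is a finite union of closed cosets. *)
Lemma zclosed_irreducible_component1C : zclosed gcoord (~` G0).
Proof.
have [m [y yP]] := irreducible_component1_index.
rewrite (_ : ~` G0 = \bigcup_(i : 'I_m) [set x | ~ G0 (y i) /\ G0 ((y i)^-1 * x)%g]).
  apply: zclosed_bigcup_ord => i; have [y0|y0] := pselect (G0 (y i)).
    rewrite (_ : [set x | _] = set0); first exact: zclosed_set0.
    by apply/seteqP; split=> // x [].
  rewrite (_ : [set x | _] = (fun x => (y i)^-1 * x)%g @^-1` G0).
    exact: zclosed_preimage (regular_map_mull _) _ irreducible_component1_closed.
  by apply/seteqP; split=> // x [].
apply/seteqP; split=> x.
  have [i yx] := yP x => x0; exists i => //; split=> // y0; apply: x0.
  by rewrite -(mulVKg (y i) x); exact: irreducible_component1_mul.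
move=> [i _ [y0 yx]] x0; apply: y0.
rewrite -[y i]invgK; apply: irreducible_component1_inv.
rewrite -(mulgK x (y i)^-1%g); apply: irreducible_component1_mul => //.
exact: irreducible_component1_inv.
Qed.

Lemma closed_zclosed (B : set (affine_space k (adim A))) :
  closed B -> zclosed gcoord (affine_coord A @^-1` B).
Proof.
move=> /zariski_closedP[S ->] x xS p Sp; apply: (xS (fun x => meval (gcoord x) p)).
  by exists p.
by move=> y; exact.
Qed.

Lemma zclosed_closed Z : zclosed gcoord Z -> closed (affine_coord A @` Z).
Proof.
move=> Zc; apply/zariski_closedP.
exists [set p | forall x, Z x -> meval (gcoord x) p = 0].
apply/seteqP; split=> [_ [x Zx <-] p|v vZ]; first exact.
have [p p0|x xv] := gcoord_closed (v := fun i => (v : 'rV_ _) ord0 i).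
  by apply: vZ => x _; exact: p0.
exists x; last by apply/rowP => i; rewrite -[LHS]/(gcoord x i) xv.
apply: Zc => f [p fp] fZ; rewrite fp xv; apply: vZ => y Zy; by rewrite -fp fZ.
Qed.

Lemma identity_componentE : identity_component A = G0.
Proof.
have coord1 : (affine_coord A @` G0) (affine_coord A 1%g).
  by exists 1%g => //; exact: irreducible_component1_1.
apply/seteqP; split=> x.
  move=> [B [B1 BG Bconn] Bx].
  (* [G0] is open and closed in [G], so it cuts out of the connected set [B] an open and closed
     subset containing the point of 1. *)
  suff BE : B `&` affine_coord A @` G0 = B.
    move: Bx; rewrite -BE => -[_ [y y0 /(affine_coord_inj (a := A)) <-]].
    exact: y0.
  apply: Bconn; first by exists (affine_coord A 1%g).
    exists (~` (affine_coord A @` ~` G0)).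
      by rewrite openC; exact/zclosed_closed/zclosed_irreducible_component1C.
    apply/seteqP; split=> v [Bv].
      move=> [y y0 yv]; split=> // -[z z0 zv]; apply: z0.
      by rewrite (affine_coord_inj (etrans zv (esym yv))).
    move=> nv; split=> //; have [y _ yv] := BG v Bv; exists y => //.
    by apply: contrapT => y0; apply: nv; exists y.
  exists (affine_coord A @` G0) => //.
  exact/zclosed_closed/irreducible_component1_closed.
move=> x0; exists (affine_coord A @` G0); last by exists x.
split=> //; first by move=> _ [y _ <-]; exists y.
(* [G0] is connected because it is irreducible: it is covered by the closed sets [D] and the
   complement of [C], hence lies in one of them. *)
move=> B [v Bv] [C Cop BC] [D Dcl BD].
apply/seteqP; split=> w; first by rewrite BD => -[].
have [| | |GD|GC] := irreducible_subU irreducible_component1_irr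
    (Z1 := affine_coord A @^-1` D) (Z2 := affine_coord A @^-1` (~` C)).
- exact: closed_zclosed.
- by apply: closed_zclosed; rewrite closedC.
- move=> y y0; have [Cy|] := pselect (C (affine_coord A y)); last by right.
  left; have : B (affine_coord A y) by rewrite BC; split=> //; exists y.
  by rewrite BD => -[].
- by move=> [y y0 <-]; rewrite BD; split; [exists y|exact: GD].
- by exfalso; move: Bv; rewrite BC => -[[y y0 <-]]; exact: GC.
Qed.

End AlgebraicGroup.

(** * Linear algebra *)

Section LinearAlgebra.
Variable k : closedFieldType.
Hypothesis natr_eq0 : forall m, (m%:R == 0 :> k) = (m == 0)%N.
Variable N : nat.
Implicit Types M : 'M[k]_N.+1.

Lemma eigenvalue_det M a : eigenvalue M a = (\det (M - a%:M) == 0).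
Proof.
by rewrite /eigenvalue /eigenspace kermx_eq0 row_free_unit unitmxE unitfE negbK.
Qed.

(** The minimal polynomial divides ['X^s - 1], so in characteristic zero its roots are simple; as
    they are roots of ['X^m - 1], it divides that polynomial. *)
Lemma expmx_eq1 M s m : (0 < s)%N -> M ^+ s = 1 ->
  (forall a, eigenvalue M a -> a ^+ m = 1) -> M ^+ m = 1.
Proof.
move=> s_gt0 Ms eig.
have [zs zsE] := closed_field_poly_normal (mxminpoly M).
rewrite (monicP (mxminpoly_monic M)) scale1r in zsE.
have zs_uniq : uniq zs.
  rewrite -separable_prod_XsubC -zsE.
  apply: (@dvdp_separable _ ('X^s - 1)).
    by apply: mxminpoly_min; rewrite rmorphB rmorph1 rmorphXn /= horner_mx_X Ms subrr.
  by apply: separable_Xn_sub_1; rewrite natr_eq0 -lt0n.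
have : mxminpoly M %| 'X^m - 1.
  rewrite zsE; apply: uniq_roots_dvdp; last by rewrite uniq_rootsE.
  apply/allP => a az; rewrite rootE !hornerE eig ?subrr //.
  by rewrite eigenvalue_root_min zsE root_prod_XsubC.
move=> /dvdpP[q qE]; apply/eqP; rewrite -subr_eq0; apply/eqP.
have := congr1 (horner_mx M) qE.
by rewrite rmorphM /= mx_root_minpoly mulr0 rmorphB rmorph1 rmorphXn /= horner_mx_X.
Qed.

(** The characteristic polynomial divides a power of ['X^m - 1], and Cayley-Hamilton applies. *)
Lemma expmx_unipotent M m : (forall a, eigenvalue M a -> a ^+ m = 1) ->
  exists d, (M ^+ m - 1) ^+ d = 0.
Proof.
move=> eig; have [zs zsE] := closed_field_poly_normal (char_poly M).
rewrite (monicP (char_poly_monic M)) scale1r in zsE.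
have : all (fun a => a ^+ m == 1) zs.
  by apply/allP => a az; rewrite eig // eigenvalue_root_char zsE root_prod_XsubC.
have {zsE} : horner_mx M (\prod_(z <- zs) ('X - z%:P)) = 0.
  by rewrite -zsE; exact: Cayley_Hamilton.
move=> zs0 zsm; exists (size zs).
have [q qE] : exists q, ('X^m - 1) ^+ size zs = q * \prod_(z <- zs) ('X - z%:P).
  elim: zs zsm {zs0} => [|z zs IHzs] /=; first by exists 1; rewrite big_nil expr0 mulr1.
  move=> /andP[/eqP zm /IHzs[q qE]].
  have /factor_theorem[r rE] : root ('X^m - 1) z.
    by rewrite rootE !hornerE zm subrr.
  by exists (q * r); rewrite big_cons exprS qE {1}rE mulrACA (mulrC _ q) mulrACA.
have := congr1 (horner_mx M) qE.
by rewrite rmorphM /= zs0 mulr0 rmorphXn rmorphB rmorph1 rmorphXn /= horner_mx_X.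
Qed.

(** A full-rank factorisation [M = C *m R] of an idempotent satisfies [R *m C = 1%:M], and the trace
    is cyclic. *)
Lemma mxtrace_idempotent M : M * M = M -> \tr M = (\rank M)%:R.
Proof.
move=> MM; move: (row_base_free M) (col_base_full M) (mulmx_base M).
move: (row_base M) (col_base M) => R C Rfree Cfull CR.
have RC : R *m C = 1%:M.
  apply: (row_free_inj Rfree); apply: (row_full_inj Cfull).
  by rewrite /= mul1mx !mulmxA CR -mulmxA CR.
by rewrite -{1}CR mxtrace_mulC RC mxtrace1.
Qed.

(** The sum divided by [m] is a projection [e] onto the fixed vectors of [M], and [i] is its rank.
    If [e] is invertible, [M * e = e] gives [M = 1]. *)
Lemma mxtrace_sum_exp M m : (0 < m)%N -> M ^+ m = 1 ->
  exists2 i, (i <= N.+1)%N & \tr (\sum_(j < m) M ^+ j) = m%:R * i%:R /\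
                             (i = N.+1 -> M = 1).
Proof.
move=> m_gt0 Mm; set S := \sum_(j < m) _.
have m0 : m%:R != 0 :> k by rewrite natr_eq0 -lt0n.
have MS : M * S = S.
  rewrite /S mulr_sumr; case: m m_gt0 Mm {S m0} => // m _ Mm.
  rewrite big_ord_recr /= -exprS Mm big_ord_recl expr0 addrC; congr (_ + _).
  by apply: eq_bigr => j _; rewrite -exprS.
have MjS j : M ^+ j * S = S.
  by elim: j => [|j IHj]; rewrite ?mul1r // exprS -mulrA IHj.
have SS : S * S = m%:R *: S.
  rewrite {1}/S mulr_suml (eq_bigr (fun=> S)) => [|j _]; last exact: MjS.
  by rewrite sumr_const card_ord scaler_nat.
pose e := m%:R^-1 *: S.
have ee : e * e = e by rewrite /e -scalerAl -scalerAr SS !scalerA -mulrA mulVf // mulr1.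
exists (\rank e); first exact: rank_leq_row.
split; first by rewrite -mxtrace_idempotent // mxtraceZ mulrA mulfV // mul1r.
move=> re; have eu : e \is a GRing.unit.
  by rewrite -[_ \is a _]/(e \in unitmx) -row_free_unit /row_free re.
apply: (mulIr eu); rewrite mul1r /e -scalerAr MS //.
Qed.

End LinearAlgebra.

(** * Functions of finite rank on a product *)

Section FiniteRank.
Variables (k : fieldType) (I J : Type).

(** These are the elements of the tensor product of the two function spaces. *)
Definition finite_rank (Phi : I * J -> k) :=
  exists s : seq ((I -> k) * (J -> k)), forall x,
    Phi x = \sum_(u <- s) u.1 x.1 * u.2 x.2.

Lemma finite_rank_l (f : I -> k) : finite_rank (fun x => f x.1).
Proof. by exists [:: (f, fun=> 1)] => x; rewrite big_seq1 mulr1. Qed.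

Lemma finite_rank_r (f : J -> k) : finite_rank (fun x => f x.2).
Proof. by exists [:: (fun=> 1, f)] => x; rewrite big_seq1 mul1r. Qed.

Lemma finite_rankD Phi Psi : finite_rank Phi -> finite_rank Psi ->
  finite_rank (fun x => Phi x + Psi x).
Proof.
by move=> [s sE] [t tE]; exists (s ++ t) => x; rewrite big_cat sE tE.
Qed.

Lemma finite_rankM Phi Psi : finite_rank Phi -> finite_rank Psi ->
  finite_rank (fun x => Phi x * Psi x).
Proof.
move=> [s sE] [t tE].
exists [seq ((fun i => u.1 i * v.1 i), (fun j => u.2 j * v.2 j)) | u <- s, v <- t] => x.
rewrite big_allpairs_dep sE tE mulr_suml; apply: eq_bigr => u _.
by rewrite mulr_sumr; apply: eq_bigr => v _ /=; rewrite mulrACA.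
Qed.

Lemma finite_rank_sum (K : finType) (Phi : K -> I * J -> k) :
  (forall a, finite_rank (Phi a)) -> finite_rank (fun x => \sum_a Phi a x).
Proof.
move=> PhiP; elim: (index_enum K) => [|a r IHr].
  by exists [::] => x; rewrite !big_nil.
by under eq_fun do rewrite big_cons; exact: finite_rankD.
Qed.

(* The rows and columns of an invertible minor of maximal size. *)
Lemma finite_rank_minor Phi : finite_rank Phi -> (exists x, Phi x != 0) ->
  exists N (row : 'I_N.+1 -> I) (col : 'I_N.+1 -> J),
    (\matrix_(s, t) Phi (row s, col t)) \in unitmx /\
    forall i, exists l : 'I_N.+1 -> k, forall j, Phi (i, j) = \sum_s l s * Phi (row s, j).
Proof.
move=> [r rE] [[i0 j0] ij0].
pose minor N (row : 'I_N -> I) (col : 'I_N -> J) := \matrix_(s, t) Phi (row s, col t).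
pose P N := `[< exists row col, @minor N row col \in unitmx >].
have exP : exists N, P N.
  exists 1%N; apply/asboolP; exists (fun=> i0), (fun=> j0).
  by rewrite unitmxE det_mx11 mxE unitfE.
(* A minor factors through a space of dimension [size r], which bounds the size of an invertible
   one. *)
have P_le N : P N -> (N <= size r)%N.
  move=> /asboolP[row [col]]; rewrite -row_free_unit => /eqP {1}<-.
  have -> : minor N row col = (\matrix_(s < N, a < size r) (tnth (in_tuple r) a).1 (row s))
      *m (\matrix_(a < size r, t < N) (tnth (in_tuple r) a).2 (col t)).
    apply/matrixP => s t; rewrite !mxE rE /= big_tnth.
    by apply: eq_bigr => a _; rewrite !mxE.
  by rewrite (leq_trans (mxrankM_maxl _ _)) // rank_leq_col.
case: (ex_maxnP exP P_le) => N /asboolP[row [col Qu]] Nmax.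
have N_gt0 : (0 < N)%N.
  by apply: Nmax; apply/asboolP; exists (fun=> i0), (fun=> j0); rewrite unitmxE det_mx11 mxE unitfE.
case: N N_gt0 row col Qu Nmax => // N _ row col Qu Nmax.
exists N, row, col; split=> // i.
set Q := minor _ _ _ in Qu.
pose C := \row_t Phi (i, col t).
exists (fun s => (C *m invmx Q) 0 s) => j.
pose B := \col_s Phi (row s, j).
suff DE : \row_(_ < 1) Phi (i, j) = C *m invmx Q *m B.
  have := congr1 (fun X : 'M_1 => X 0 0) DE; rewrite mxE => ->.
  by rewrite mxE; apply: eq_bigr => s _; rewrite !mxE.
set D := \row__ _; apply/eqP; rewrite -subr_eq0; apply: contraT => DE.
pose row' (s : 'I_(N.+1 + 1)) := if fintype.split s is inl s' then row s' else i.
pose col' (s : 'I_(N.+1 + 1)) := if fintype.split s is inl s' then col s' else j.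
have : (N.+1 + 1 <= N.+1)%N; last by rewrite addn1 ltnn.
apply: Nmax; apply/asboolP; exists row', col'.
have -> : minor _ row' col' = block_mx Q B C D.
  apply/matrixP => s t; rewrite mxE /row' /col' -(splitK s) -(splitK t).
  by case: (fintype.split s) => s'; case: (fintype.split t) => t'; rewrite !unsplitK /=
    ?block_mxEul ?block_mxEur ?block_mxEdl ?block_mxEdr !mxE.
(* Schur complement: were row [i] not the predicted combination at [j], the minor bordered by [i]
   and [j] would be invertible, against maximality. *)
have -> : block_mx Q B C D =
    block_mx 1%:M 0 (C *m invmx Q) 1%:M *m block_mx Q B 0 (D - C *m invmx Q *m B).
  by rewrite mulmx_block !mul1mx !mul0mx !addr0 mulmxKV // addrC subrK.
rewrite unitmxE det_mulmx det_lblock det_ublock !det1 !mul1r unitfE mulf_neq0 //.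
  by rewrite -unitfE -unitmxE.
rewrite det_mx11; apply: contraNneq DE => d0; apply/eqP/matrixP => a b.
by rewrite !ord1 d0 mxE.
Qed.

End FiniteRank.

(** * A faithful representation *)

Section Linearization.
Variables (k : closedFieldType) (G : groupType) (A : affine_algebraic_group k G).
Local Notation gcoord := (gcoord (A := A)).

(* The matrix coefficients are taken in the span of the left translates of the coordinate
   functions; the constant function is added so that the dimension is positive. *)
Lemma linearization : exists N (r : G -> 'M[k]_N.+1),
  [/\ forall x y, r (x * y)%g = r x * r y, r 1%g = 1,
      forall s t, regular gcoord (fun x => r x s t) &
      forall i, exists L : 'M[k]_N.+1, forall x,
        gcoord x i = \sum_s \sum_t L s t * r x s t].
Proof.
(* The first argument indexes a translate of a coordinate function, or the constant 1 for [None];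
   the second is the point of evaluation. *)
pose Phi (x : (option 'I_(adim A) * G) * G) :=
  if x.1.1 is Some i then gcoord (x.1.2 * x.2)%g i else 1.
have PhiP : finite_rank Phi.
  pose Psi (o : option 'I_(adim A)) (x : (option 'I_(adim A) * G) * G) :=
    if o is Some i then gcoord (x.1.2 * x.2)%g i else 1.
  rewrite (_ : Phi = fun x => \sum_o (x.1.1 == o)%:R * Psi o x).
    apply: finite_rank_sum => o; apply: finite_rankM.
      exact: finite_rank_l (fun x => (x.1 == o)%:R).
    case: o => [i|]; last exact: finite_rank_l (fun=> 1).
    apply: gcoord_mul_closed => [a| | |j|j].
    - exact: finite_rank_l (fun=> a).
    - exact: finite_rankD.
    - exact: finite_rankM.
    - exact: finite_rank_l (fun x => gcoord x.2 j).
    - exact: finite_rank_r (fun x => gcoord x j).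
  apply: funext => x; rewrite (bigD1 x.1.1) //= eqxx mul1r big1 ?addr0 //.
  by move=> o /negbTE oE; rewrite eq_sym oE mul0r.
have [|N [row [col [Qu spanP]]]] := finite_rank_minor PhiP.
  by exists ((None, 1%g), 1%g); rewrite oner_eq0.
have [l lE] := choice spanP.
set Q := \matrix_(s, t) _ in Qu.
have PhiM o a b d : Phi ((o, a), (b * d)%g) = Phi ((o, (a * b)%g), d).
  by rewrite /Phi /=; case: o => // i; rewrite mulgA.
(* The matrix of translation by [x] in the basis formed by the selected rows. *)
pose r x := \matrix_(s, t) l ((row s).1, ((row s).2 * x)%g) t.
pose V x := \matrix_(s, t) Phi (((row s).1, ((row s).2 * x)%g), col t).
have rPhi x s b : Phi (((row s).1, ((row s).2 * x)%g), b) = \sum_t r x s t * Phi (row t, b).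
  by rewrite lE; apply: eq_bigr => t _; rewrite !mxE.
have rQ x : r x *m Q = V x.
  by apply/matrixP => s t; rewrite !mxE rPhi; apply: eq_bigr => u _; rewrite [Q u t]mxE.
(* Evaluation at the selected columns determines [r x]; multiplicativity and regularity are read off
   from this formula. *)
have rE x : r x = V x *m invmx Q by rewrite -rQ mulmxK.
exists N, r; split.
- move=> x y; rewrite rE -[RHS](mulmxK Qu) -[r x * r y]/(r x *m r y); congr (_ *m _).
  rewrite -mulmxA rQ; apply/matrixP => s t; rewrite !mxE mulgA -PhiM rPhi.
  by apply: eq_bigr => u _; congr (_ * _); rewrite [RHS]mxE -PhiM -surjective_pairing.
- rewrite rE (_ : V 1%g = Q) ?mulmxV //.
  by apply/matrixP => s t; rewrite !mxE mulg1 -surjective_pairing.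
- move=> s t; rewrite (_ : (fun x => _) = (fun x => \sum_u V x s u * invmx Q u t)).
    apply: regular_sum => u; apply: regularM; last exact: regular_cst.
    rewrite (_ : (fun x => _) = (fun x => Phi (((row s).1, ((row s).2 * x)%g), col u))).
      rewrite /Phi /=; case: (row s).1 => [i|]; last exact: regular_cst.
      apply: regular_map_mul (regular_map_cst _) _.
      exact: regular_map_mull.
    by apply: funext => x; rewrite mxE.
  by apply: funext => x; rewrite rE mxE.
(* Expand the coordinate function in the basis, then write the value at [x] of a basis function as
   the value at 1 of its translate. *)
- move=> i; exists (\matrix_(s, t) (l (Some i, 1%g) s * Phi (row t, 1%g))) => x.
  have -> : gcoord x i = Phi ((Some i, 1%g), x) by rewrite /Phi /= mul1g.
  rewrite lE; apply: eq_bigr => s _.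
  have -> : Phi (row s, x) = Phi (((row s).1, ((row s).2 * x)%g), 1%g).
    by rewrite -PhiM mulg1 -surjective_pairing.
  by rewrite rPhi mulr_sumr; apply: eq_bigr => t _; rewrite [in RHS]mxE mulrA mulrAC.
Qed.

End Linearization.

(** * Polynomial functions on the line *)

Section PolynomialFunctions.
Variable k : closedFieldType.

Lemma poly_vanish (Q : {poly k}) : (forall t, Q.[t] = 0) -> Q = 0.
Proof.
move=> Q0; apply/eqP; apply: contraT => /closed_nonrootP[t].
by rewrite /root Q0 eqxx.
Qed.

Definition polyfun (f : k -> k) := exists Q : {poly k}, forall t, f t = Q.[t].

Lemma polyfun_cst a : polyfun (fun=> a).
Proof. by exists a%:P => t; rewrite hornerC. Qed.

Lemma polyfun_id : polyfun id.
Proof. by exists 'X => t; rewrite hornerX. Qed.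

Lemma polyfunD f g : polyfun f -> polyfun g -> polyfun (fun t => f t + g t).
Proof. by move=> [P fP] [Q gQ]; exists (P + Q) => t; rewrite hornerD fP gQ. Qed.

Lemma polyfunM f g : polyfun f -> polyfun g -> polyfun (fun t => f t * g t).
Proof. by move=> [P fP] [Q gQ]; exists (P * Q) => t; rewrite hornerM fP gQ. Qed.

Lemma polyfun_comp f g : polyfun f -> polyfun g -> polyfun (fun t => f (g t)).
Proof. by move=> [P fP] [Q gQ]; exists (P \Po Q) => t; rewrite horner_comp fP gQ. Qed.

Lemma polyfun_sum (I : Type) (r : seq I) (F : I -> k -> k) :
  (forall i, polyfun (F i)) -> polyfun (fun t => \sum_(i <- r) F i t).
Proof.
move=> FP; elim: r => [|i r IHr].
  by under eq_fun do rewrite big_nil; exact: polyfun_cst.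
by under eq_fun do rewrite big_cons; exact: polyfunD.
Qed.

Lemma polyfun_prod (I : Type) (r : seq I) (F : I -> k -> k) :
  (forall i, polyfun (F i)) -> polyfun (fun t => \prod_(i <- r) F i t).
Proof.
move=> FP; elim: r => [|i r IHr].
  by under eq_fun do rewrite big_nil; exact: polyfun_cst.
by under eq_fun do rewrite big_cons; exact: polyfunM.
Qed.

Lemma polyfun_meval n (v : k -> 'I_n -> k) (p : mpoly n k) :
  (forall i, polyfun (v ^~ i)) -> polyfun (fun t => meval (v t) p).
Proof. exact: (meval_closed polyfun_cst polyfunD polyfunM). Qed.

Lemma regular1_poly (f : ('I_1 -> k) -> k) : regular (fun z => z) f ->
  exists Q : {poly k}, forall z, f z = Q.[z ord0].
Proof.
move=> [p fp]; have [Q QE] := polyfun_meval p (fun=> polyfun_id).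
exists Q => z; rewrite fp -QE; apply: meval_eq => i.
by rewrite (ord1 i).
Qed.

Lemma irreducible_line : irreducible (fun z : 'I_1 -> k => z) setT.
Proof.
split; first by exists (fun=> 0).
move=> f g /regular1_poly[P fP] /regular1_poly[Q gQ] fg.
have /eqP : P * Q = 0.
  by apply: poly_vanish => t; rewrite hornerM -(fP (fun=> t)) -(gQ (fun=> t)) fg.
rewrite mulf_eq0 => /orP[]/eqP PQ0; [left|right] => z _.
  by rewrite fP PQ0 horner0.
by rewrite gQ PQ0 horner0.
Qed.

Hypothesis natr_eq0 : forall m, (m%:R == 0 :> k) = (m == 0)%N.

Lemma natr_inj : injective (fun m => m%:R : k).
Proof.
move=> i j /= ij; wlog le_ij : i j ij / (i <= j)%N.
  by move=> wl; have [ij'|/ltnW ji] := leqP i j; [exact: wl|exact/esym/wl].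
apply/eqP; rewrite eqn_leq le_ij /= -subn_eq0 -natr_eq0 natrB //.
by rewrite ij subrr.
Qed.

Lemma poly_vanish_nat (Q : {poly k}) j0 :
  (forall j, (j0 <= j)%N -> Q.[j%:R] = 0) -> Q = 0.
Proof.
move=> Q0; apply: (@roots_geq_poly_eq0 _ _ [seq j%:R | j <- iota j0 (size Q)]).
- apply/allP => _ /mapP[j + ->]; rewrite mem_iota => /andP[j0j _].
  by rewrite /root Q0.
- by rewrite map_inj_uniq ?iota_uniq //; exact: natr_inj.
- by rewrite size_map size_iota.
Qed.

(** In characteristic zero the naturals form an infinite subset of [k], so identities for powers
    extend to a parameter in [k]. *)
Lemma polyfun_eq f g : polyfun f -> polyfun g ->
  (forall j : nat, f j%:R = g j%:R) -> f =1 g.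
Proof.
move=> [P fP] [Q gQ] fg t; rewrite fP gQ; congr (_.[_]).
apply/eqP; rewrite -subr_eq0; apply/eqP; apply: (@poly_vanish_nat _ 0) => j _.
by rewrite hornerD hornerN -fP -gQ fg subrr.
Qed.

Lemma root_of_unity_exponent (zs : seq k) : exists2 m, (0 < m)%N &
  forall z, z \in zs -> (exists2 s, (0 < s)%N & z ^+ s = 1) -> z ^+ m = 1.
Proof.
elim: zs => [|z zs [m m_gt0 mP]]; first by exists 1%N.
have [[s s_gt0 zsE]|zn] := pselect (exists2 s, (0 < s)%N & z ^+ s = 1).
  exists (s * m)%N => [|y]; first by rewrite muln_gt0 s_gt0.
  rewrite inE => /orP[/eqP-> _|/mP ym /ym yE].
    by rewrite exprM zsE expr1n.
  by rewrite mulnC exprM yE expr1n.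
by exists m => // y; rewrite inE => /orP[/eqP-> /zn|/mP].
Qed.

(** The generalised binomial coefficient, polynomial in [t]. *)
Definition gbinomial (t : k) i : k := (i`!%:R)^-1 * \prod_(l < i) (t - l%:R).

Lemma gbinomial_nat (j i : nat) : gbinomial j%:R i = 'C(j, i)%:R.
Proof.
have fi : (i`!)%:R != 0 :> k by rewrite natr_eq0 -lt0n fact_gt0.
apply: (mulfI fi); rewrite /gbinomial mulVKf // -natrM mulnC bin_ffact.
elim: i {fi} => [|i IHi]; first by rewrite big_ord0.
rewrite big_ord_recr /= IHi ffactnSr natrM.
have [ij|ji] := leqP i j; first by rewrite natrB.
by rewrite ffact_small // !mul0r.
Qed.

Lemma polyfun_gbinomial i : polyfun (gbinomial ^~ i).
Proof.
apply: polyfunM (polyfun_cst _) _; apply: polyfun_prod => l.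
by apply: polyfunD polyfun_id _; exact: polyfun_cst.
Qed.

(** The binomial expansion stops at [d]; the number of terms no longer depends on [j], and the
    coefficients are polynomial in [j]. *)
Lemma unipotent_exp_binomial N (M : 'M[k]_N.+1) d : (M - 1) ^+ d = 0 ->
  forall j : nat, M ^+ j = \sum_(i < d) gbinomial j%:R i *: (M - 1) ^+ i.
Proof.
move=> Md j; set U := M - 1 in Md *.
have -> : M = 1 + U by rewrite addrC subrK.
rewrite exprDn_comm; last exact/commr_sym/commr1.
have Ud i : (d <= i)%N -> U ^+ i = 0.
  by move=> /subnK <-; rewrite exprD Md mulr0.
(* This range covers both sums: the extra terms vanish on one side by the binomial coefficient, on
   the other by nilpotency. *)
transitivity (\sum_(i < d + j.+1) 'C(j, i)%:R *: U ^+ i).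
  rewrite addnC big_split_ord /= [X in _ = _ + X]big1 ?addr0.
    apply: eq_bigr => i _; by rewrite expr1n mul1r scaler_nat.
  by move=> i _; rewrite bin_small ?scale0r //= addSn ltnS leq_addr.
rewrite big_split_ord /= [X in _ + X]big1 ?addr0.
  by apply: eq_bigr => i _; rewrite gbinomial_nat.
by move=> i _; rewrite Ud ?scaler0 // leq_addr.
Qed.

End PolynomialFunctions.

(** * Pigeonhole principle and powers of conjugates *)

Lemma pigeonhole_seq (T : eqType) (f : nat -> T) (s : seq T) :
  (forall i, f i \in s) -> exists i j, (i < j)%N /\ f i = f j.
Proof.
move=> fs; apply: contrapT => nij.
have f_inj : injective f.
  move=> i j fij; apply/eqP; rewrite eqn_leq.
  by apply/andP; split; rewrite leqNgt; apply/negP => ij; apply: nij; [exists j, i|exists i, j].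
have : (size [seq f i | i <- iota 0 (size s).+1] <= size s)%N.
  apply: uniq_leq_size; first by rewrite map_inj_uniq ?iota_uniq.
  by move=> _ /mapP[i _ ->].
by rewrite size_map size_iota ltnn.
Qed.

Lemma expg_conj (G : groupType) (h x : G) m : ((h * x * h^-1) ^+ m = h * x ^+ m * h^-1)%g.
Proof.
elim: m => [|m IHm]; first by rewrite !expg0 mulg1 mulgV.
by rewrite !expgS IHm !mulgA mulgVK.
Qed.

(** * Periodic cosets *)

Section PeriodicCosets.
Variables (k : closedFieldType) (G : groupType) (A : affine_algebraic_group k G).
Hypothesis natr_eq0 : forall m, (m%:R == 0 :> k) = (m == 0)%N.
Variables (N : nat) (r : G -> 'M[k]_N.+1).
Hypothesis rM : forall x y, r (x * y)%g = r x * r y.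
Hypothesis r1 : r 1%g = 1.
Hypothesis r_regular : forall s t, regular (gcoord (A := A)) (fun x => r x s t).
Variable L : 'I_(adim A) -> 'M[k]_N.+1.
Hypothesis gcoordE : forall i x, gcoord (A := A) x i = \sum_s \sum_t L i s t * r x s t.
Local Notation gcoord := (gcoord (A := A)).
Local Notation H := (irreducible_component1 A).

Lemma rep_inj : injective r.
Proof.
move=> x y rxy; apply: (gcoord_inj (A := A)); apply: funext => i.
by rewrite !gcoordE rxy.
Qed.

Lemma rep_exp x m : r (x ^+ m)%g = r x ^+ m.
Proof. by elim: m => [|m IHm]; rewrite ?r1 // expgS rM IHm exprS. Qed.

Lemma left_cosetP (g x : G) : left_coset g H x <-> H (g^-1 * x)%g.
Proof.
split=> [[h Hh <-]|Hx]; first by rewrite mulKg.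
by exists (g^-1 * x)%g => //; rewrite mulVKg.
Qed.

Lemma left_coset_id (g : G) : left_coset g H g.
Proof. by apply/left_cosetP; rewrite mulVg; exact: irreducible_component1_1. Qed.

Lemma left_coset_eq (g x : G) : left_coset g H x -> left_coset x H = left_coset g H.
Proof.
move=> /left_cosetP gx; apply/seteqP; split=> y /left_cosetP xy; apply/left_cosetP.
  by rewrite -(mulVKg x y) mulgA; exact: irreducible_component1_mul.
rewrite -(mulVKg g y) mulgA; apply: irreducible_component1_mul => //.
by rewrite -[g in (_ * g)%g]invgK -invgM; exact: irreducible_component1_inv.
Qed.

Lemma left_coset_closed (g : G) : zclosed gcoord (left_coset g H).
Proof.
rewrite (_ : left_coset g H = (fun x => g^-1 * x)%g @^-1` H).
  exact: zclosed_preimage (regular_map_mull _) _ (@irreducible_component1_closed _ _ A).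
by apply/seteqP; split=> x /left_cosetP.
Qed.

Lemma left_coset_irr (g : G) : irreducible gcoord (left_coset g H).
Proof.
have irrH := irreducible_component1_irr A.
exact: (irreducible_image (@regular_map_mull _ _ A g) irrH).
Qed.

(** * From periodicity to finitely many fixed points *)

Lemma regular_rep_trace m : regular gcoord (fun x => \tr (\sum_(j < m) r x ^+ j)).
Proof.
rewrite (_ : (fun x => _) = (fun x => \sum_(j < m) \sum_s r (x ^+ j)%g s s)).
  apply: regular_sum => j; apply: regular_sum => s.
  exact: (regular_comp (regular_map_exp j (@regular_map_id _ _ A)) (r_regular s s)).
apply: funext => x; rewrite raddf_sum; apply: eq_bigr => j _.
by rewrite rep_exp.
Qed.

Lemma finite_exponent_finite (C : set G) m : zclosed gcoord C -> (0 < m)%N ->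
  (forall x y, C x -> C y -> C (x^-1 * y)%g) -> (forall x, C x -> (x ^+ m)%g = 1%g) ->
  finite_set C.
Proof.
move=> Cc m_gt0 CV Cm.
have [d [Y [Yirr CY]]] := irreducible_decomposition Cc.
have [y Yy] := choice (fun i => (Yirr i).1.1).
apply: (@sub_finite_set _ _ (range y)); last exact: finite_image.
move=> x /CY[i Yx]; exists i => //; have [Yi_irr YC] := Yirr i.
(* Translate the piece to pass through 1, where the trace is known. *)
pose Y' := (fun x => (y i)^-1 * x)%g @` Y i.
have Y'irr : irreducible gcoord Y' := irreducible_image (regular_map_mull _) Yi_irr.
have Y'C : Y' `<=` C by move=> _ [z /YC Cz <-]; exact/CV/Cz/YC.
have trE z : Y' z -> exists2 j, (j <= N.+1)%N &
    \tr (\sum_(j < m) r z ^+ j) = m%:R * j%:R /\ (j = N.+1 -> r z = 1).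
  by move=> /Y'C /Cm zm; apply: mxtrace_sum_exp => //; rewrite -rep_exp zm.
have Y'1 : Y' 1%g by exists (y i); rewrite ?mulVg.
have Y'x : Y' ((y i)^-1 * x)%g by exists x.
have tr_cst := irreducible_finite_range (s := [seq m%:R * j%:R | j <- iota 0 N.+2])
  Y'irr (regular_rep_trace m).
have := tr_cst _ _ _ Y'x Y'1 => /(_ _)/wrap[].
  move=> z /trE[j jN [-> _]]; by apply/mapP; exists j; rewrite ?mem_iota.
have [j jN [-> rx1]] := trE _ Y'x; rewrite r1.
under eq_bigr do rewrite expr1n.
rewrite sumr_const card_ord -scaler_nat mxtraceZ mxtrace1.
have m0 : m%:R != 0 :> k by rewrite natr_eq0 -lt0n.
(* The constant value of the trace is the one at 1, so the eigenvalue 1 has full multiplicity and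
   the piece is the single point [y i]. *)
move=> /(mulfI m0) /(natr_inj natr_eq0) /rx1; rewrite -r1 => /rep_inj yx.
by rewrite -(mulVKg (y i) x) yx mulg1.
Qed.

(** Coordinates realising [G * k] as a closed subset of affine space; the scalar is coordinate
    [ord0]. *)
Definition gcoord_eig (x : G * k) : 'I_(adim A).+1 -> k := ext (gcoord x.1) x.2.

Lemma gcoord_eig_closed v :
  (forall p : mpoly (adim A).+1 k, (forall x, meval (gcoord_eig x) p = 0) ->
    meval v p = 0) -> exists x, gcoord_eig x = v.
Proof.
move=> v0; have [p p0|x xv] := gcoord_closed (A := A) (v := fun i => v (lift ord0 i)).
  have [q qE] : regular (fun v : 'I_(adim A).+1 -> k => v)
      (fun v => meval (fun i => v (lift ord0 i)) p).
    by apply: regular_meval => i; exact: regular_coord.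
  rewrite qE; apply: v0 => y; rewrite -qE -[RHS](p0 y.1); apply: meval_eq => i.
  by rewrite /gcoord_eig /ext liftK.
exists (x, v ord0); apply: funext => i; rewrite /gcoord_eig /ext /=.
have [j ->|->] := unliftP ord0 i; last by rewrite ?unlift_none.
by rewrite ?liftK xv.
Qed.

Lemma eigenvalue_exp (M : 'M[k]_N.+1) a m : eigenvalue M a -> eigenvalue (M ^+ m) (a ^+ m).
Proof.
move=> /eigenvalueP[v vM v0]; apply/eigenvalueP; exists v => //.
elim: m => [|m IHm]; first by rewrite !expr0 mulmx1 scale1r.
rewrite exprS -[M * _]/(M *m _) mulmxA vM -scalemxAl IHm scalerA -exprS //.
Qed.

Lemma eigenvalue1 (a : k) : eigenvalue (1 : 'M[k]_N.+1) a -> a = 1.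
Proof.
move=> /eigenvalueP[v]; rewrite mulmx1 -{1}[v]scale1r => /eqP.
rewrite -subr_eq0 -scalerBl scaler_eq0 => /orP[|/eqP->]; last by rewrite eqxx.
by rewrite subr_eq0 => /eqP.
Qed.

Lemma periodic_eigenvalue (X : set G) x a : periodic X -> X x -> eigenvalue (r x) a ->
  exists2 s, (0 < s)%N & a ^+ s = 1.
Proof.
move=> Xper /Xper[s s_gt0 xs] /(eigenvalue_exp s); rewrite -rep_exp xs r1.
by move=> /eigenvalue1 as1; exists s.
Qed.

Lemma periodic_bounded_exponent (X : set G) : zclosed gcoord X -> periodic X ->
  exists2 m, (0 < m)%N & forall x, X x -> (x ^+ m)%g = 1%g.
Proof.
move=> Xc Xper.
(* Pairs of an element of [X] and one of its eigenvalues; the second projection is the constructible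
   set of all eigenvalues. *)
pose X' := [set x : G * k | X x.1 /\ \det (r x.1 - x.2%:M) = 0].
have r_fst i : regular gcoord_eig (fun x => gcoord x.1 i).
  rewrite (_ : (fun x => _) = gcoord_eig ^~ (lift ord0 i)); first exact: regular_coord.
  by apply: funext => x; rewrite /gcoord_eig /ext liftK.
have r_snd : regular gcoord_eig snd.
  rewrite (_ : snd = gcoord_eig ^~ ord0); first exact: regular_coord.
  by apply: funext => x; rewrite /gcoord_eig /ext unlift_none.
have r_mx i j : regular gcoord_eig (fun x => (r x.1 - x.2%:M) i j).
  rewrite (_ : (fun x => _) = (fun x => r x.1 i j - x.2 * (i == j)%:R)).
    apply: regularB; first exact: (regular_comp r_fst (r_regular _ _)).
    by apply: regularM r_snd _; exact: regular_cst.
  by apply: funext => x; rewrite !mxE mulr_natr.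
have X'c : zclosed gcoord_eig X'.
  apply: (zclosedI (Y := fst @^-1` X)); first exact: zclosed_preimage Xc.
  apply: zclosed_zero; apply: regular_sum => p; apply: regularM.
    exact: regular_cst.
  by apply: regular_prod => i; exact: r_mx.
have u_reg (i : 'I_1) : regular gcoord_eig (fun x => x.2) by exact: r_snd.
have := generically_decided_zimage gcoord_eig_closed X'c u_reg => /(_ _ (irreducible_line k)).
move=> [q [/regular1_poly[Q QE] [z0 _ qz0] qP]].
have Q0 : Q != 0 by apply: contraNneq qz0 => Q0; rewrite QE Q0 horner0.
case: qP => qP.
  (* Here every non-root of [Q] is an eigenvalue. Naturals from 2 on are not roots of unity, so [Q]
     would vanish at all of them; the bound excludes 1. *)
  exfalso; move/eqP: Q0; apply; apply: (@poly_vanish_nat _ natr_eq0 _ 2) => j j_gt1.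
  apply/eqP; apply: contrapT => /negP Qj.
  have [|[x a] [/= Xx /eqP]] := qP (fun=> j%:R) I; first by rewrite QE.
  rewrite -eigenvalue_det => eig aj.
  have [s s_gt0 as1] := periodic_eigenvalue Xper Xx eig.
  have {}aj : a = j%:R by have := congr1 (@^~ ord0) aj.
  move: as1; rewrite aj -natrX -[1]/(1%:R) => /(natr_inj natr_eq0) js.
  by have := ltn_exp2l 0 s j_gt1; rewrite js expn0 s_gt0.
(* Now all eigenvalues are among the finitely many roots of [Q], which gives a common exponent. *)
have [zs zsE] := closed_field_poly_normal Q.
have [m m_gt0 mP] := root_of_unity_exponent zs; exists m => // x Xx.
have [s s_gt0 xs] := Xper x Xx.
apply: rep_inj; rewrite rep_exp r1; apply: (expmx_eq1 natr_eq0 s_gt0).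
  by rewrite -rep_exp xs.
move=> a eig; apply: mP; last exact: periodic_eigenvalue Xper Xx eig.
have : root Q a.
  rewrite rootE; apply: contrapT => /negP Qa; apply: (qP (fun=> a)) => //.
    by rewrite QE.
  exists (x, a) => //; split=> //=; apply/eqP; by rewrite -eigenvalue_det.
by rewrite zsE rootZ ?lead_coef_eq0 // root_prod_XsubC.
Qed.

Lemma fixed_pointsP (g h : G) : fixed_points H (conj_aut g) h <-> H h /\ commute g h.
Proof.
rewrite /fixed_points /conj_aut /=; split=> -[Hh gh]; split=> //.
  by rewrite /commute -{1}gh !mulgA mulgV mul1g.
by rewrite -mulgA -gh mulKg.
Qed.

Lemma periodic_finite_fixed (g : G) :
  periodic (left_coset g H) -> finite_set (fixed_points H (conj_aut g)).
Proof.
move=> gper; have [m m_gt0 mP] := periodic_bounded_exponent (@left_coset_closed g) gper.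
apply: (@finite_exponent_finite _ m) => //.
- rewrite (_ : fixed_points _ _ = H `&` [set h | (g * h = h * g)%g]).
    apply: zclosedI; first exact: irreducible_component1_closed.
    by apply: zclosed_equalizer; [exact: regular_map_mull|exact: regular_map_mulr].
  by apply/seteqP; split=> h /fixed_pointsP.
- move=> x y /fixed_pointsP[Hx gx] /fixed_pointsP[Hy gy]; apply/fixed_pointsP; split.
    by apply: irreducible_component1_mul => //; exact: irreducible_component1_inv.
  by apply: commuteM => //; exact: commuteV.
- move=> x /fixed_pointsP[Hx gx].
  have : ((g * x) ^+ m = 1)%g by apply: mP; exists x.
  by rewrite expgMn // (mP g (left_coset_id g)) mul1g.
Qed.

(** * From finitely many fixed points to transitivity *)

Lemma regular_map_orbit (x : G) : regular_map A (fun h => h * x * h^-1)%g.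
Proof.
apply: regular_map_mul; first exact: regular_map_mulr.
by apply: regular_map_inv; exact: regular_map_id.
Qed.

(** Two elements of [H] have the same image exactly when they differ on the right by a fixed point,
    so the fibres are finite. *)
Lemma finite_fixed_dominant (g : G) : finite_set (fixed_points H (conj_aut g)) ->
  H `<=` zclosure gcoord ((fun h => g^-1 * (h * g * h^-1))%g @` H).
Proof.
move=> fin; apply: finite_fibres_dominant.
- exact: gcoord_inj.
- exact: gcoord_closed.
- exact: (regular_map_mul (@regular_map_cst _ _ A g^-1%g) (regular_map_orbit g)).
- exact: irreducible_component1_closed.
- exact: irreducible_component1_irr.
- move=> _ [h Hh <-]; rewrite !mulgA.
  apply: irreducible_component1_mul; last exact: irreducible_component1_inv.
  exact: irreducible_component1_conjV.
- move=> h Hh; apply: (@sub_finite_set _ _ ((fun c => h * c)%g @` fixed_points H (conj_aut g))).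
    move=> h' [Hh' /mulgI hg]; exists (h^-1 * h')%g; last by rewrite mulVKg.
    apply/fixed_pointsP; split.
      by apply: irreducible_component1_mul => //; exact: irreducible_component1_inv.
    apply: (mulgI h); apply: (mulIg (h'^-1)%g).
    by rewrite /commute !mulgA mulgK -hg mulgV mul1g.
  exact: finite_image.
Qed.

Lemma finite_fixed_finite_order (g : G) :
  finite_set (fixed_points H (conj_aut g)) -> finite_order g.
Proof.
move=> /finite_seqP[s sE]; have [m m_gt0 Hm] := irreducible_component1_expg A g.
have [i|i [j [ij gij]]] := @pigeonhole_seq _ (fun i => (g ^+ m) ^+ i)%g s.
  have : fixed_points H (conj_aut g) ((g ^+ m) ^+ i)%g.
    apply/fixed_pointsP; split; last by apply: commuteX; exact: commuteX.
    elim: i => [|i IHi]; first exact: irreducible_component1_1.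
    by rewrite expgS; exact: irreducible_component1_mul.
  by rewrite sE.
exists (m * (j - i))%N; first by rewrite muln_gt0 m_gt0 subn_gt0.
by rewrite expgnA (expgnFr _ (ltnW ij)) gij mulgV.
Qed.

(** The condition that the [m]-th power be 1 is closed and holds on the conjugates of [g], which are
    dense in the coset. *)
Lemma finite_fixed_periodic (g : G) :
  finite_set (fixed_points H (conj_aut g)) -> periodic (left_coset g H).
Proof.
move=> fin; have [m m_gt0 gm] := finite_fixed_finite_order fin.
move=> _ [h Hh <-]; exists m => //.
apply: (gcoord_inj (A := A)); apply: funext => i.
have rgx : regular gcoord (fun x => gcoord ((g * x) ^+ m)%g i).
  exact: (regular_map_exp m (@regular_map_mull _ _ A g)).
apply/eqP; rewrite -subr_eq0; apply/eqP.
apply: (finite_fixed_dominant fin Hh (f := fun x => gcoord ((g * x) ^+ m)%g i - gcoord 1%g i)).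
  by apply: regularB => //; exact: regular_cst.
by move=> _ [x Hx <-]; rewrite mulVKg expg_conj gm mulg1 mulgV subrr.
Qed.

Lemma finite_fixed_transitive (g : G) :
  finite_set (fixed_points H (conj_aut g)) -> conj_transitive H (left_coset g H).
Proof.
move=> fin; have gper := finite_fixed_periodic fin.
pose orb x h := gcoord (h * x * h^-1)%g.
have orb_open x : left_coset g H x -> exists q, [/\ regular (fun z => z) q,
    exists2 y, left_coset g H y & q (gcoord y) != 0 &
    forall y, left_coset g H y -> q (gcoord y) != 0 ->
      exists2 h, H h & (h * x * h^-1 = y)%g].
  move=> gx; have xH := left_coset_eq gx.
  (* Periodicity of the coset returns finiteness of the fixed points for each [x] in it, not only
     for [g]. *)
  have xfin : finite_set (fixed_points H (conj_aut x)).
    by apply: periodic_finite_fixed; rewrite xH.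
  have orb_reg i : regular gcoord (orb x ^~ i) by exact: (regular_map_orbit x).
  have [q [rq [h Hh qh] qP]] := image_contains_open (gcoord_closed (A := A))
    (@irreducible_component1_closed _ _ A) (irreducible_component1_irr A) orb_reg.
  exists q; split=> //.
    exists (h * x * h^-1)%g => //; rewrite -xH; apply/left_cosetP; rewrite !mulgA.
    apply: irreducible_component1_mul; last exact: irreducible_component1_inv.
    exact: irreducible_component1_conjV.
  move=> y; rewrite -xH => -[z Hz <-] qy.
  (* By dominance for [x], the whole coset lies in the closure of the orbit of [x]. *)
  have [|h' Hh' /(@gcoord_inj _ _ A) h'y] := qP (gcoord (x * z)%g) _ qy.
    move=> f rf f0.
    have rfx : regular gcoord (fun z => f (gcoord (x * z)%g)).
      exact: (regular_comp (F := fun z => gcoord (x * z)%g) (@regular_map_mull _ _ A x) rf).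
    apply: (finite_fixed_dominant xfin Hz rfx) => _ [h' Hh' <-].
    by rewrite mulVKg f0 //; exists h'.
  by exists h'.
move=> x y /orb_open[p [rp [x' gx' px'] pP]] /orb_open[q [rq [y' gy' qy'] qP]].
(* Two nonempty open subsets of the irreducible coset meet. *)
have [z [gz pz qz]] : exists z, [/\ left_coset g H z, p (gcoord z) != 0 & q (gcoord z) != 0].
  apply: contrapT => nz.
  have rpc : regular gcoord (fun z => p (gcoord z)).
    exact: (regular_comp (F := gcoord) (@regular_coord _ _ _ gcoord) rp).
  have rqc : regular gcoord (fun z => q (gcoord z)).
    exact: (regular_comp (F := gcoord) (@regular_coord _ _ _ gcoord) rq).
  have [|p0|q0] := (left_coset_irr g).2 _ _ rpc rqc.
  - move=> z gz; apply/eqP; rewrite mulf_eq0; apply: contrapT => /negP.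
    by rewrite negb_or => /andP[pz qz]; apply: nz; exists z.
  - by move: px'; rewrite p0 ?eqxx.
  - by move: qy'; rewrite q0 ?eqxx.
have [h Hh hx] := pP z gz pz; have [h' Hh' h'y] := qP z gz qz.
exists (h'^-1 * h)%g.
  by apply: irreducible_component1_mul => //; exact: irreducible_component1_inv.
by rewrite invgM invgK !mulgA -(mulgA _ h x) -(mulgA _ _ h^-1%g) hx -h'y !mulgA mulVg mul1g mulgVK.
Qed.

(** * From transitivity to periodicity *)

Section OneParameter.
Variables (u : G) (d : nat).
Hypothesis u_unip : (r u - 1) ^+ d = 0.

(** The binomial series for [u^t] has polynomial coordinates. The equations of [G] hold along it at
    the naturals, hence everywhere, so the curve stays in [G]. *)
Lemma one_parameter : exists gamma : k -> G,
  (forall i, polyfun (fun t => gcoord (gamma t) i)) /\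
  forall j : nat, gamma j%:R = (u ^+ j)%g.
Proof.
pose U t := \sum_(i < d) gbinomial t i *: (r u - 1) ^+ i.
pose w t i := \sum_s \sum_t' L i s t' * U t s t'.
have wP i : polyfun (w ^~ i).
  apply: polyfun_sum => s; apply: polyfun_sum => s'; apply: polyfunM (polyfun_cst _) _.
  rewrite (_ : (fun t => _) = fun t => \sum_(j < d) gbinomial t j * ((r u - 1) ^+ j) s s').
    by apply: polyfun_sum => j; apply: polyfunM (polyfun_gbinomial _ _) (polyfun_cst _).
  by apply: funext => t; rewrite summxE; apply: eq_bigr => j _; rewrite mxE.
have wE (j : nat) : w j%:R = gcoord (u ^+ j)%g.
  apply: funext => i; rewrite gcoordE rep_exp (unipotent_exp_binomial natr_eq0 u_unip).
  by [].
have /choice[gamma gammaE] t : exists x, gcoord x = w t.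
  apply: gcoord_closed => p p0.
  have := polyfun_eq natr_eq0 (polyfun_meval p wP) (polyfun_cst 0).
  by apply=> j; rewrite wE p0.
exists gamma; split=> [i|j]; first by under eq_fun do rewrite gammaE.
by apply: (gcoord_inj (A := A)); rewrite gammaE wE.
Qed.

End OneParameter.

Definition polycurve (F : k -> G) := forall i, polyfun (fun t => gcoord (F t) i).

Lemma polycurve_mul F1 F2 : polycurve F1 -> polycurve F2 ->
  polycurve (fun t => F1 t * F2 t)%g.
Proof.
by apply: gcoord_mul_closed; [exact: polyfun_cst|exact: polyfunD|exact: polyfunM].
Qed.

Lemma polycurve_exp F m : polycurve F -> polycurve (fun t => F t ^+ m)%g.
Proof.
by apply: gcoord_exp_closed; [exact: polyfun_cst|exact: polyfunD|exact: polyfunM].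
Qed.

Lemma polycurve_cst g : polycurve (fun=> g).
Proof. by move=> i; exact: polyfun_cst. Qed.

Lemma polycurve_comp F f : polycurve F -> polyfun f -> polycurve (fun t => F (f t)).
Proof. by move=> FP fP i; exact: (polyfun_comp (FP i) fP). Qed.

Lemma polycurve_eq F1 F2 : polycurve F1 -> polycurve F2 ->
  (forall j : nat, F1 j%:R = F2 j%:R) -> forall t, F1 t = F2 t.
Proof.
move=> P1 P2 F12 t; apply: (gcoord_inj (A := A)); apply: funext => i.
by apply: (polyfun_eq natr_eq0 (P1 i) (P2 i)) => j; rewrite F12.
Qed.

Lemma transitive_eigenvalue (g : G) a : conj_transitive H (left_coset g H) ->
  eigenvalue (r g) a -> exists2 s, (0 < s)%N & a ^+ s = 1.
Proof.
move=> trans eig; have [m m_gt0 Hm] := irreducible_component1_expg A g.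
have [zs zsE] := closed_field_poly_normal (char_poly (r g)).
have zsP b : eigenvalue (r g) b -> b \in zs.
  by rewrite eigenvalue_root_char zsE rootZ ?root_prod_XsubC // lead_coef_eq0
    monic_neq0 // char_poly_monic.
have Hmi i : H ((g ^+ m) ^+ i)%g.
  elim: i => [|i IHi]; first exact: irreducible_component1_1.
  by rewrite expgS; exact: irreducible_component1_mul.
have r_inv x : r x^-1%g * r x = 1 by rewrite -rM mulVg r1.
have r_invr x : r x *m r x^-1%g = 1%:M by rewrite -[_ *m _]/(r x * _) -rM mulgV r1.
(* [g * (g ^+ m) ^+ i] is in the coset, hence conjugate to [g], and the two have the same
   eigenvalues. *)
have eig_exp i : eigenvalue (r g) (a ^+ (m * i).+1).
  have [|h Hh hg] := trans g (g * (g ^+ m) ^+ i)%g (left_coset_id g).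
    by exists ((g ^+ m) ^+ i)%g.
  have := eigenvalue_exp (m * i).+1 eig.
  rewrite -rep_exp expgS expgnA -hg !rM => /eigenvalueP[v vE v0].
  apply/eigenvalueP; exists (v *m r h).
    have gh : r h * r g = r h * r g * r h^-1%g * r h by rewrite -mulrA r_inv mulr1.
    by rewrite scalemxAl -vE -[LHS]mulmxA -[RHS]mulmxA; congr (v *m _).
  by apply: contraNneq v0 => vh0; rewrite -[v]mulmx1 -(r_invr h) mulmxA vh0 mul0mx.
have a0 : a != 0.
  apply/eqP => a0; move: eig => /eigenvalueP[v vE v0]; move/eqP: v0; apply.
  by rewrite -[v]mulmx1 -(r_invr g) mulmxA vE a0 scale0r mul0mx.
have [i|i [j [ij aij]]] := @pigeonhole_seq _ (fun i => a ^+ (m * i).+1) zs.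
  exact/zsP/eig_exp.
exists (m * (j - i))%N; first by rewrite muln_gt0 m_gt0 subn_gt0.
apply: (mulfI (expf_neq0 (m * i).+1 a0)).
by rewrite -exprD mulr1 aij addSn -mulnDr subnKC // ltnW.
Qed.

(* With [u = g ^+ m] unipotent and [gamma t = u^t], the element [g * gamma (- 1 / m)] of
   the coset has order dividing [m]. *)
Lemma transitive_periodic (g : G) :
  conj_transitive H (left_coset g H) -> periodic (left_coset g H).
Proof.
move=> trans; have [m1 m1_gt0 Hm1] := irreducible_component1_expg A g.
have [zs zsE] := closed_field_poly_normal (char_poly (r g)).
have [m2 m2_gt0 m2P] := root_of_unity_exponent zs.
(* The factor [m1] puts [g ^+ m] in [H]; the factor [m2] makes its eigenvalues 1. *)
pose m := (m1 * m2)%N; have m_gt0 : (0 < m)%N by rewrite muln_gt0 m1_gt0.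
have m0 : m%:R != 0 :> k by rewrite natr_eq0 -lt0n.
pose u := (g ^+ m)%g.
have gu : commute g u by exact: commuteX.
have Huj j : H (u ^+ j)%g.
  rewrite /u /m expgnA -(expgnA (g ^+ m1)%g); elim: (m2 * j)%N => [|i IHi].
    exact: irreducible_component1_1.
  by rewrite expgS; exact: irreducible_component1_mul.
have [a eig|d ud] := @expmx_unipotent _ _ (r g) m.
  rewrite /m mulnC exprM m2P ?expr1n //; last exact: transitive_eigenvalue eig.
  by move: eig; rewrite eigenvalue_root_char zsE rootZ ?root_prod_XsubC // lead_coef_eq0
    monic_neq0 // char_poly_monic.
rewrite -rep_exp -/u in ud; have [gamma [gammaP gammaE]] := one_parameter ud.
(* This and the following properties of [gamma] are polynomial in [t], so they are checked at
   naturals, where [gamma] gives the powers of [u]. *)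
have gamma_scale t : gamma (m%:R * t) = (gamma t ^+ m)%g.
  have lin : polyfun (fun t : k => m%:R * t) := polyfunM (polyfun_cst _) (@polyfun_id k).
  have := polycurve_eq (polycurve_comp gammaP lin) (polycurve_exp m gammaP).
  by apply=> j; rewrite -natrM !gammaE mulnC expgnA.
have gamma_shift t : (u * gamma t)%g = gamma (t + 1).
  have lin : polyfun (fun t : k => t + 1) := polyfunD (@polyfun_id k) (polyfun_cst _).
  have := polycurve_eq (polycurve_mul (polycurve_cst u) gammaP) (polycurve_comp gammaP lin).
  by apply=> j; rewrite natr1 !gammaE expgS.
have gamma_comm t : commute g (gamma t).
  have := polycurve_eq (polycurve_mul (polycurve_cst g) gammaP)
                       (polycurve_mul gammaP (polycurve_cst g)).
  by apply=> j; rewrite gammaE; exact: commuteX.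
have gammaH t : H (gamma t).
  apply: irreducible_component1_closed => f [p fp] f0; rewrite fp.
  apply: (polyfun_eq natr_eq0 (polyfun_meval p gammaP) (polyfun_cst 0)) => j.
  by rewrite gammaE -fp f0.
(* The power equals [u * gamma (-1)], that is [gamma 0]. *)
have xm : ((g * gamma (- m%:R^-1)) ^+ m = 1)%g.
  rewrite expgMn; last exact: gamma_comm.
  rewrite -gamma_scale mulrN mulfV // gamma_shift addNr.
  by rewrite -[0]/(0%:R) gammaE expg0.
have gx : left_coset g H (g * gamma (- m%:R^-1))%g by exists (gamma (- m%:R^-1)).
move=> y gy; have [h _ <-] := trans _ _ gx gy; exists m => //.
by rewrite expg_conj xm mulg1 mulgV.
Qed.

End PeriodicCosets.

(** * Equivalence of the three conditions *)

Theorem theorem1 (k : closedFieldType) (char_k : [pchar k]%R =i pred0)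
    (G : groupType) (A : affine_algebraic_group k G) (g : G) :
  let H := identity_component A in
  [<-> periodic (left_coset g H);
       finite_set (fixed_points H (conj_aut g));
       conj_transitive H (left_coset g H)].
Proof.
have natr_eq0 := (pcharf0P k).1 char_k.
have [N [r [rM r1 r_reg /choice[L LE]]]] := linearization A.
rewrite /= identity_componentE; tfae.
- exact: (periodic_finite_fixed natr_eq0 rM r1 r_reg LE).
- exact: (finite_fixed_transitive natr_eq0 rM r1 r_reg LE).
- exact: (transitive_periodic natr_eq0 rM r1 LE).
Qed.
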